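(* Let $0<r<R$ and let $p(x)=\sum_{n=2}^\infty \frac{a_n}{x^n}$ be a real analytic function, the series being absolutely convergent for $|x|>r$, such that $p(x)\ge 0$ for all real $x$ with $|x|\ge R$. Let $\lambda$ be the positive measure $\lambda(dx)=p(x)\mathbf{1}_{\{|x|\ge R\}}(x)\,dx$ on $(-\infty,-R]\cup[R,\infty)$. Then the Stieltjes transform $G_\lambda(z)$, defined for $z\in\mathbb{C}_-$, has an analytic continuation $\widetilde{G}_\lambda$ to $\mathbb{C}_-\cup\{z\in\mathbb{C} : |z|>R\}$, and there are complex numbers $b_n$ ($n\ge 0$) such that $\widetilde{G}_\lambda$ is given by the convergent series $$\widetilde{G}_\lambda(z)=\sum_{n=0}^\infty \frac{b_n}{z^{n+1}},\qquad |z|>R.$$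
   Context: $\mathbb{C}_-=\{z\in\mathbb{C} : \operatorname{Im} z<0\}$. For a finite positive measure $\lambda$ on $\mathbb{R}$, the Stieltjes transform is $G_\lambda(z)=\int_{\mathbb{R}}\frac{\lambda(dx)}{z-x}$ for $z\in\mathbb{C}\setminus\mathbb{R}$. The continuation is from $\mathbb{C}_-$ only; $\widetilde{G}_\lambda$ need not agree with $G_\lambda$ on the upper half plane. *)

(* Defs.v *)
From mathcomp Require Import all_boot all_order all_algebra.
From mathcomp Require Import all_classical all_reals all_analysis.
From mathcomp Require Import complex.
Set Implicit Arguments.
Unset Strict Implicit.
Unset Printing Implicit Defensive.
Import Order.TTheory GRing.Theory Num.Theory.
Import numFieldNormedType.Exports.
Local Open Scope classical_set_scope.
Local Open Scope ring_scope.
Local Open Scope complex_scope.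

Definition has_sum (K : numFieldType) (u : nat -> K) (l : K) : Prop :=
  series u @ \oo --> l.

(* Used at K := R[i] for complex analyticity.  For an open U, the neighbourhood
   of z0 on which f is given by its power series may be shrunk to lie in U, so
   the values of f outside U are irrelevant. *)
Definition analytic_on (K : numFieldType) (U : set K) (f : K -> K) : Prop :=
  forall z0 : K, U z0 ->
    exists c : nat -> K,
      \forall z \near z0, has_sum (fun n => c n * (z - z0) ^+ n) (f z).

(* The integral is total: it is meaningful when the real and imaginary parts
   are integrable. *)
Definition complex_integral (d : measure_display) (T : measurableType d)
    (R : realType) (mu : {measure set T -> \bar R}) (f : T -> R[i]) : R[i] :=
  Rintegral mu setT (fun x => complex.Re (f x)) +i*
  Rintegral mu setT (fun x => complex.Im (f x)).

Definition stieltjes_transform (R : realType)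
    (mu : {measure set (measurableTypeR R) -> \bar R}) (z : R[i]) : R[i] :=
  complex_integral mu (fun x : R => (z - x%:C)^-1).

Definition lower_half_plane (R : realType) : set R[i] :=
  [set z | complex.Im z < 0].

(* The norm of R[i] takes its values in R[i]; on z and rho%:C the order of R[i]
   compares real numbers. *)
Definition disk_exterior (R : realType) (rho : R) : set R[i] :=
  [set z | rho%:C < `|z|].

(* Main.v *)
(* By partial fractions, the integral of [x ^- n.+2 / (z - x)] over [|x| >= rho]
   equals [z^-1] times the sum of the integral of [x ^- n.+2] and of the integral
   of [x ^- n.+1 / (z - x)].  This reduces the monomial densities to the single
   integral of [x^-1 / (z - x)], whose antiderivative is a branch of
   [- log (z - x)]: symmetric cut-offs give [pi * i] at infinity, and the boundary
   terms at [rho] and [- rho] expand as logarithmic series for [|z| > rho].  Hence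
   each monomial density has an expansion in [z ^- k.+1], with coefficients of
   order [rho ^+ k / rho ^+ n]; absolute convergence of the series of [p] at [rho]
   allows the double series to be exchanged.  The two analytic pieces (the integral
   on the lower half plane, the Laurent series outside the disk) agree on the
   overlap, so they glue. *)
From HB Require Import structures.
Require Import Defs.
From mathcomp Require Import all_boot all_order all_algebra.
From mathcomp Require Import all_classical all_reals all_analysis.
From mathcomp Require Import complex.
From mathcomp Require Import measurable_realfun ring lra.
Import Order.TTheory GRing.Theory Num.Theory.
Import numFieldNormedType.Exports.
Import Normc.
Local Open Scope classical_set_scope.
Local Open Scope ring_scope.
Local Open Scope complex_scope.

Set Implicit Arguments.
Unset Strict Implicit.
Unset Printing Implicit Defensive.

(** * Complex modulus and complex series *)

(** Since [r < rho], the coefficients are summable at the endpoint [rho] itself. On the exterior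
    every error can therefore be bounded by a numerical tail times the single integrable weight
    [x ^- 2], and every limit is an explicit estimate with an error tending to 0. The obstacle is
    the integral of [x^-1 / (z - x)]: it converges absolutely, but neither of its partial fractions
    does. They are never separated. The antiderivative of their sum is [ln |x|] plus a branch of
    [- log (z - x)]; the real logarithms cancel at infinity, while the argument turns by [pi], with
    a sign fixed by [Im z < 0]. Derivatives and integrals are taken on real and imaginary parts,
    which costs only a factor 2 in the bounds. The measure is known only through its values on sets,
    so a Radon-Nikodym argument is needed to integrate the kernel against it. *)

Section NormcTheory.
Variable R : rcfType.
Implicit Types x y z : R[i].

Lemma normcE z : `|z| = (normc z)%:C.
Proof. by []. Qed.

Lemma normc_ge0 z : 0 <= normc z.
Proof. by case: z => a b; exact: sqrtr_ge0. Qed.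

Lemma normc_eq0 z : (normc z == 0) = (z == 0).
Proof. by apply/eqP/eqP => [/eq0_normc//|->]; rewrite normc0. Qed.

Lemma normc_gt0 z : (0 < normc z) = (z != 0).
Proof. by rewrite lt_neqAle normc_ge0 andbT eq_sym normc_eq0. Qed.

Lemma ler_normcD x y : normc (x + y) <= normc x + normc y.
Proof. exact: le_normcD. Qed.

Lemma normc_opp z : normc (- z) = normc z.
Proof. exact: normcN. Qed.

Lemma ler_normcB x y : normc (x - y) <= normc x + normc y.
Proof. by rewrite -(normc_opp y); exact: ler_normcD. Qed.

Lemma normcX z n : normc (z ^+ n) = normc z ^+ n.
Proof. by elim: n => [|n IH]; rewrite ?expr0 ?normc1// !exprS normcM IH. Qed.

Lemma normc_real (x : R) : normc x%:C = `|x|.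
Proof. by rewrite /normc /= expr0n/= addr0 sqrtr_sqr. Qed.

Lemma ler_normc_sum (I : Type) (s : seq I) (P : pred I) (F : I -> R[i]) :
  normc (\sum_(i <- s | P i) F i) <= \sum_(i <- s | P i) normc (F i).
Proof.
elim/big_ind2 : _ => [|a b c d ab cd|//]; first by rewrite normc0.
by apply: (le_trans (ler_normcD _ _)); exact: lerD.
Qed.

Lemma normRe_le z : `|complex.Re z| <= normc z.
Proof.
case: z => a b /=; rewrite -(sqrtr_sqr a); apply: ler_wsqrtr.
by rewrite lerDl sqr_ge0.
Qed.

Lemma normIm_le z : `|complex.Im z| <= normc z.
Proof.
case: z => a b /=; rewrite -(sqrtr_sqr b); apply: ler_wsqrtr.
by rewrite lerDr sqr_ge0.
Qed.

Lemma normc_le_ReIm z : normc z <= `|complex.Re z| + `|complex.Im z|.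
Proof.
case: z => a b /=; rewrite -[leRHS]ger0_norm ?addr_ge0//.
rewrite -(sqrtr_sqr (`|a| + `|b|)); apply: ler_wsqrtr.
rewrite sqrrD !real_normK ?num_real//.
by rewrite -addrA lerD2l lerDr pmulrn_lge0// mulr_ge0.
Qed.

Lemma ReD x y : complex.Re (x + y) = complex.Re x + complex.Re y.
Proof. by case: x y => ? ? [? ?]. Qed.

Lemma ImD x y : complex.Im (x + y) = complex.Im x + complex.Im y.
Proof. by case: x y => ? ? [? ?]. Qed.

Lemma ReB x y : complex.Re (x - y) = complex.Re x - complex.Re y.
Proof. by case: x y => ? ? [? ?]. Qed.

Lemma ImB x y : complex.Im (x - y) = complex.Im x - complex.Im y.
Proof. by case: x y => ? ? [? ?]. Qed.

Lemma ReM x y : complex.Re (x * y) =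
  complex.Re x * complex.Re y - complex.Im x * complex.Im y.
Proof. by case: x y => ? ? [? ?]. Qed.

Lemma ImM x y : complex.Im (x * y) =
  complex.Re x * complex.Im y + complex.Im x * complex.Re y.
Proof. by case: x y => ? ? [? ?]. Qed.

Lemma Re_sum (I : Type) (s : seq I) (P : pred I) (F : I -> R[i]) :
  complex.Re (\sum_(i <- s | P i) F i) = \sum_(i <- s | P i) complex.Re (F i).
Proof. exact: (big_morph _ ReD). Qed.

Lemma Im_sum (I : Type) (s : seq I) (P : pred I) (F : I -> R[i]) :
  complex.Im (\sum_(i <- s | P i) F i) = \sum_(i <- s | P i) complex.Im (F i).
Proof. exact: (big_morph _ ImD). Qed.

End NormcTheory.

Local Arguments normc : simpl never.

(* Stating convergence for a declared [numFieldType] selects the topology of [R[i]],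
   which [u @ \oo --> l] alone does not infer. *)
Definition seq_cvg (K : numFieldType) (u : nat -> K) (l : K) : Prop :=
  u @ \oo --> l.

Section HasSum.
Variable K : numFieldType.
Implicit Types (u v : nat -> K) (l m : K).

Lemma has_sum_uniq u l1 l2 : has_sum u l1 -> has_sum u l2 -> l1 = l2.
Proof. by move=> h1 h2; exact: (cvg_unique _ h1 h2). Qed.

Lemma has_sumZ u l (c : K) : has_sum u l -> has_sum (fun n => c * u n) (c * l).
Proof.
rewrite /has_sum => ul; rewrite (_ : series _ = fun n => c * series u n).
  by apply: cvgM => //; exact: cvg_cst.
by apply/funext => n; rewrite /series/= big_distrr.
Qed.

Lemma has_sumD u v l m : has_sum u l -> has_sum v m ->
  has_sum (fun n => u n + v n) (l + m).
Proof.
rewrite /has_sum => ul vm.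
rewrite (_ : series _ = fun n => series u n + series v n); first exact: cvgD.
by apply/funext => n; rewrite /series/= big_split.
Qed.

Lemma has_sum_cons u l : has_sum (fun n => u n.+1) l -> has_sum u (u 0%N + l).
Proof.
rewrite /has_sum => ul; rewrite -cvg_shiftS.
rewrite (_ : [sequence _]_n = fun n => u 0%N + series (fun n => u n.+1) n).
  by apply: cvgD => //; exact: cvg_cst.
by apply/funext => n; rewrite /series/= big_nat_recl.
Qed.

End HasSum.

Section ComplexSeries.
Variable R : realType.
Implicit Types (u v : nat -> R[i]) (l : R[i]).

(** The radii in the definition of convergence are elements of [R[i]]; a positive one is real, so
    nothing is lost by passing to real null sequences. *)
Lemma cvgcP u l :
  seq_cvg u l <-> (fun n => normc (u n - l)) @ \oo --> (0 : R).
Proof.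
split=> [/cvgrPdist_lt ul|/cvgrPdist_lt ul]; apply/cvgrPdist_lt.
  move=> e e0; have := ul e%:C; rewrite ltcR => /(_ e0).
  apply: filterS => n; rewrite normcE ltcR.
  by rewrite sub0r normrN ger0_norm ?normc_ge0// -normc_opp opprB.
move=> e e0; have := ul (complex.Re e).
have er : e = (complex.Re e)%:C by rewrite RRe_real// gtr0_real.
rewrite er ltcR in e0; move=> /(_ e0); apply: filterS => n.
rewrite er normcE ltcR.
by rewrite sub0r normrN ger0_norm ?normc_ge0// -normc_opp opprB.
Qed.

Lemma cvgc_ReIm u l :
  (fun n => complex.Re (u n)) @ \oo --> complex.Re l ->
  (fun n => complex.Im (u n)) @ \oo --> complex.Im l ->
  seq_cvg u l.
Proof.
move=> ure uim; apply/cvgcP.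
have h : (fun n => `|complex.Re (u n) - complex.Re l| +
                   `|complex.Im (u n) - complex.Im l|) @ \oo --> (0 : R).
  rewrite -[X in _ --> X]addr0; apply: cvgD.
    by apply/norm_cvg0P; apply/subr_cvg0.
  by apply/norm_cvg0P; apply/subr_cvg0.
apply: (squeeze_cvgr _ (cvg_cst 0) h).
apply: nearW => n; rewrite normc_ge0/=.
by rewrite -ReB -ImB; exact: normc_le_ReIm.
Qed.

Lemma cvgc_bound u l (e : nat -> R) : e @ \oo --> (0 : R) ->
  (\forall n \near \oo, normc (u n - l) <= e n) -> seq_cvg u l.
Proof.
move=> e0 ule; apply/cvgcP; apply: (squeeze_cvgr _ (cvg_cst 0) e0).
by apply: filterS ule => n ->; rewrite normc_ge0.
Qed.

(** A total sum, so that it can serve as a witness; it is meaningful only for convergent series,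
    which [has_csum] secures by a majorant. *)
Definition csum u : R[i] :=
  limn (series (fun n => complex.Re (u n))) +i*
  limn (series (fun n => complex.Im (u n))).

Lemma has_csum u (A : nat -> R) : (forall n, normc (u n) <= A n) ->
  cvgn (series A) -> has_sum u (csum u).
Proof.
move=> uA cA.
have A0 n : 0 <= A n by apply: le_trans (uA n); exact: normc_ge0.
have cr (f : R[i] -> R) : (forall z, `|f z| <= normc z) ->
    cvgn (series (fun n => f (u n))).
  move=> fn; apply: (@normed_cvg _ R^o).
  apply: (series_le_cvg _ _ _ cA) => n.
  - exact: normr_ge0.
  - exact: A0.
  - exact: (le_trans (fn (u n)) (uA n)).
apply: cvgc_ReIm => /=.
  under eq_fun do rewrite /series/= Re_sum.
  exact: (cr (@complex.Re R) (@normRe_le R)).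
under eq_fun do rewrite /series/= Im_sum.
exact: (cr (@complex.Im R) (@normIm_le R)).
Qed.

Lemma normc_csum_le u (A : nat -> R) : (forall n, normc (u n) <= A n) ->
  cvgn (series A) -> normc (csum u) <= limn (series A).
Proof.
move=> uA cA; have /cvgcP h : has_sum u (csum u) := has_csum uA cA.
apply/ler_addgt0Pl => e e0.
move/cvgrPdist_lt : h => /(_ _ e0) [N _ /(_ N (leqnn N))] /=.
rewrite sub0r normrN ger0_norm ?normc_ge0// => h.
have A0 n : 0 <= A n by apply: le_trans (uA n); exact: normc_ge0.
rewrite -[csum u](subrK (series u N)).
apply: (le_trans (ler_normcD _ _)); rewrite lerD//.
  by rewrite -normc_opp opprB ltW.
apply: (@le_trans _ _ (series A N)).
  apply: (le_trans (ler_normc_sum _ _ _)).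
  by apply: ler_sum => i _; exact: uA.
apply: nondecreasing_cvgn_le => //.
by apply: nondecreasing_series => n _ _; exact: A0.
Qed.

End ComplexSeries.

(** * Exchanging the order of summation in a double series *)

Section DoubleSeries.
Variable R : realType.

Lemma ler_cvg0 (x c : R) (e : nat -> R) : e @ \oo --> (0 : R) ->
  (\forall n \near \oo, x <= c + e n) -> x <= c.
Proof.
move=> e0 xce; have h : (fun n => c + e n) @ \oo --> c.
  by rewrite -[X in _ --> X]addr0; apply: cvgD => //; exact: cvg_cst.
by rewrite -(cvg_lim _ h)//; apply: limr_ge => //; apply/cvg_ex; exists c.
Qed.

Lemma cvg_series_tail (A : nat -> R) (c : R) : cvgn (series A) ->
  (fun N => c * (limn (series A) - series A N)) @ \oo --> (0 : R).
Proof.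
move=> cA; rewrite -[X in _ --> X](mulr0 c) -(subrr (limn (series A))).
apply: cvgM; first exact: cvg_cst.
by apply: cvgB => //; exact: cvg_cst.
Qed.

Lemma series_ler_lim (A : nat -> R) N : (forall n, 0 <= A n) ->
  cvgn (series A) -> series A N <= limn (series A).
Proof.
move=> A0 cA; apply: nondecreasing_cvgn_le => //.
by apply: nondecreasing_series => n _ _; exact: A0.
Qed.

Lemma series_tail_ge0 (A : nat -> R) N : (forall n, 0 <= A n) ->
  cvgn (series A) -> 0 <= limn (series A) - series A N.
Proof. by move=> A0 cA; rewrite subr_ge0; exact: series_ler_lim. Qed.

Lemma has_sum_tail (v : nat -> R[i]) (l : R[i]) (A : nat -> R) N :
  has_sum v l -> (forall n, normc (v n) <= A n) -> cvgn (series A) ->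
  normc (l - series v N) <= limn (series A) - series A N.
Proof.
move=> /cvgcP vl vA cA.
have A0 n : 0 <= A n by apply: le_trans (vA n); exact: normc_ge0.
apply: (ler_cvg0 vl); exists N => // N' /= NN'.
rewrite -[l - _](subrKA (series v N')) addrC; apply: (le_trans (ler_normcD _ _)).
rewrite -(normc_opp (l - _)) opprB lerD//.
rewrite sub_series_geq//; apply: (le_trans (ler_normc_sum _ _ _)).
apply: (@le_trans _ _ (series A N' - series A N)).
  by rewrite sub_series_geq//; apply: ler_sum => i _; exact: vA.
by rewrite lerD2r; exact: series_ler_lim.
Qed.

Lemma series_scale (A : nat -> R) (c : R) :
  series (fun n => c * A n) = (fun N => c * series A N).
Proof. by apply/funext => n; rewrite /series/= big_distrr. Qed.

Lemma cvg_series_scale (A : nat -> R) (c : R) : cvgn (series A) ->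
  cvgn (series (fun n => c * A n)).
Proof.
move=> cA; rewrite series_scale; apply/cvg_ex; exists (c * limn (series A)).
by apply: cvgM => //; exact: cvg_cst.
Qed.

Lemma lim_series_scale (A : nat -> R) (c : R) : cvgn (series A) ->
  limn (series (fun n => c * A n)) = c * limn (series A).
Proof.
move=> cA; apply/cvg_lim => //; rewrite series_scale.
by apply: cvgM => //; exact: cvg_cst.
Qed.

(** With a majorant in product form, row and column tails are controlled by the tails of [B] and
    [A]. For fixed [K] the error is at most [a * (b - series B K)] plus a term vanishing as [N]
    grows; then [K] tends to infinity. *)
Lemma has_sum_exchange (u : nat -> nat -> R[i]) (A B : nat -> R)
    (s t : nat -> R[i]) (S : R[i]) :
  (forall n, 0 <= A n) -> (forall k, 0 <= B k) ->
  (forall n k, normc (u n k) <= A n * B k) ->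
  cvgn (series A) -> cvgn (series B) ->
  (forall n, has_sum (u n) (s n)) -> has_sum s S ->
  (forall k, has_sum (fun n => u n k) (t k)) -> has_sum t S.
Proof.
move=> A0 B0 uAB cA cB us sS ut.
set a := limn (series A); set b := limn (series B).
apply: (@cvgc_bound _ _ _ (fun K => a * (b - series B K))).
  exact: cvg_series_tail.
apply: nearW => K.
have e0 : (fun N => b * (a - series A N) + normc (series s N - S)) @ \oo -->
    (0 : R).
  rewrite -[X in _ --> X]addr0; apply: cvgD; first exact: cvg_series_tail.
  exact/cvgcP.
apply: (ler_cvg0 e0); apply: nearW => N.
(* Both partial sums are compared through the finite rectangle of indices [n < N], [k < K], where
   the order of summation is free. *)
have -> : series t K - S =
    (\sum_(0 <= k < K) (t k - series (u^~ k) N)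
    - \sum_(0 <= n < N) (s n - series (u n) K)) + (series s N - S).
  rewrite !sumrB /series/= exchange_big/=.
  ring.
apply: (le_trans (ler_normcD _ _)); rewrite addrA lerD//.
apply: (le_trans (ler_normcB _ _)); rewrite [leLHS]addrC; apply: lerD.
  apply: (le_trans (ler_normc_sum _ _ _)).
  apply: (@le_trans _ _ (\sum_(0 <= n < N) A n * (b - series B K))).
    apply: ler_sum => n _.
    have := has_sum_tail K (us n) (uAB n) (cvg_series_scale (c := A n) cB).
    by rewrite lim_series_scale// series_scale -mulrBr.
  rewrite -mulr_suml; apply: ler_wpM2r; first exact: series_tail_ge0.
  exact: (@series_ler_lim A).
apply: (le_trans (ler_normc_sum _ _ _)).
apply: (@le_trans _ _ (\sum_(0 <= k < K) B k * (a - series A N))).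
  apply: ler_sum => k _.
  have uBA n : normc (u n k) <= B k * A n by rewrite mulrC.
  have := has_sum_tail N (ut k) uBA (cvg_series_scale (c := B k) cA).
  by rewrite lim_series_scale// series_scale -mulrBr.
rewrite -mulr_suml; apply: ler_wpM2r; first exact: series_tail_ge0.
exact: (@series_ler_lim B).
Qed.

End DoubleSeries.

(** * Local power series of a Laurent series at infinity *)

Section LaurentAnalytic.
Variable R : realType.

(** The left side is one term of the binomial expansion of the right. It trades binomial
    coefficients for a geometric majorant that factors over [n] and [m]. *)
Lemma bin_le_expr (s t : R) (n m : nat) : 0 <= s -> 0 <= t ->
  'C(n + m, n)%:R * s ^+ m * t ^+ n <= (s + t) ^+ (n + m).
Proof.
move=> s0 t0; have nlt : (n < (n + m).+1)%N by rewrite ltnS leq_addr.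
rewrite exprDn (bigD1 (Ordinal nlt))//= addKn.
rewrite -[X in X + _]mulr_natl mulrA lerDl sumr_ge0// => i _.
by rewrite mulrn_wge0// mulr_ge0// exprn_ge0.
Qed.

Lemma cvgc_expr0 (x : R[i]) : normc x < 1 -> seq_cvg (fun n => x ^+ n) 0.
Proof.
move=> x1; apply: (@cvgc_bound _ _ _ (fun n => normc x ^+ n)).
  by apply: cvg_expr; rewrite ger0_norm ?normc_ge0.
by apply: nearW => n; rewrite subr0 normcX.
Qed.

Lemma cvgc_bin_expr0 (x : R[i]) n : normc x < 1 ->
  seq_cvg (fun m => 'C(n + m, n)%:R * x ^+ m) 0.
Proof.
(* Half of the gap below 1: [t] is positive, so its powers can be divided by, and [s + t] stays
   below 1. *)
set s := normc x => s1; pose t := (1 - s) / 2.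
have s0 : 0 <= s := normc_ge0 x.
have t0 : 0 < t by rewrite divr_gt0// subr_gt0.
have st : s + t < 1 by rewrite /t; lra.
apply: (@cvgc_bound _ _ _ (fun m => (s + t) ^+ n / t ^+ n * (s + t) ^+ m)).
  rewrite -[X in _ --> X](mulr0 ((s + t) ^+ n / t ^+ n)).
  apply: cvgM; first exact: cvg_cst.
  by apply: cvg_expr; rewrite ger0_norm// addr_ge0// ltW.
apply: nearW => m; rewrite subr0 normcM normcX -/s.
have -> : normc ('C(n + m, n)%:R : R[i]) = 'C(n + m, n)%:R.
  by rewrite -(rmorph_nat (real_complex R)) normc_real ger0_norm.
rewrite mulrAC -exprD ler_pdivlMr ?exprn_gt0//.
by apply: bin_le_expr => //; exact: ltW.
Qed.

Lemma cvgc_cst (K : numFieldType) (l : K) : seq_cvg (fun=> l) l.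
Proof. exact: cvg_cst. Qed.

Lemma cvgc_sub (K : numFieldType) (u v : nat -> K) (l m : K) :
  seq_cvg u l -> seq_cvg v m -> seq_cvg (fun n => u n - v n) (l - m).
Proof. by move=> ul vm; apply: cvgB. Qed.

Lemma cvgc_scale (K : numFieldType) (u : nat -> K) (c l : K) :
  seq_cvg u l -> seq_cvg (fun n => c * u n) (c * l).
Proof. by move=> ul; apply: cvgM => //; exact: cvg_cst. Qed.

(** Induction on [n]: by Pascal's rule, multiplying a partial sum of order [n.+1] by [1 - x] gives
    the partial sum of order [n] minus one boundary term, which tends to 0. *)
Lemma has_sum_neg_bin (x : R[i]) n : normc x < 1 ->
  has_sum (fun m => 'C(n + m, n)%:R * x ^+ m) ((1 - x)^-1 ^+ n.+1).
Proof.
move=> x1; have x1n : 1 - x != 0.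
  apply/eqP => /eqP; rewrite subr_eq0 => /eqP xE.
  by move: x1; rewrite -xE normc1 ltxx.
have crec (u v e : nat -> R[i]) l : (forall M, (1 - x) * u M = v M - e M) ->
    seq_cvg v l -> seq_cvg e 0 -> seq_cvg u ((1 - x)^-1 * l).
  move=> uve vl e0; rewrite -[l]subr0.
  rewrite (_ : u = fun M => (1 - x)^-1 * (v M - e M)).
    by apply: cvgc_scale; exact: cvgc_sub.
  by apply/funext => M; rewrite -uve mulrA mulVf// mul1r.
elim: n => [|n IH].
  rewrite expr1 -[_^-1]mulr1.
  apply: (crec _ (fun=> 1) (fun M => x ^+ M)); first last.
  - exact: cvgc_expr0.
  - exact: cvgc_cst.
  move=> M; rewrite /series/=.
  elim: M => [|M IH]; first by rewrite big_geq// mulr0 expr0 subrr.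
  rewrite big_nat_recr//= mulrDr IH bin0 exprS; ring.
rewrite exprS.
apply: (crec _ (series (fun m => 'C(n + m, n)%:R * x ^+ m))
              (fun M => 'C(n + M, n.+1)%:R * x ^+ M)); first last.
(* The boundary coefficient ['C(n + m, n.+1)] is at most ['C(n.+1 + m, n.+1)], so [cvgc_bin_expr0]
   applies. *)
- apply: (@cvgc_bound _ _ _
     (fun m => normc ('C(n.+1 + m, n.+1)%:R * x ^+ m - 0))).
    by apply/cvgcP; exact: cvgc_bin_expr0.
  apply: nearW => m; rewrite !subr0 !normcM ler_wpM2r ?normc_ge0//.
  rewrite -!(rmorph_nat (real_complex R)) !normc_real !ger0_norm//.
  by rewrite ler_nat addSn binS leq_addr.
- exact: IH.
move=> M; rewrite /series/=.
elim: M => [|M IHM].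
  by rewrite !big_geq// mulr0 addn0 bin_small// mul0r subrr.
rewrite !big_nat_recr//= mulrDr IHM addnS addSn binS natrD exprS; ring.
Qed.

Lemma analytic_on_normc (U : set R[i]) (f : R[i] -> R[i]) :
  (forall z0, U z0 -> exists c : nat -> R[i], exists2 d : R, 0 < d &
    forall z, normc (z - z0) < d ->
      has_sum (fun n => c n * (z - z0) ^+ n) (f z)) ->
  analytic_on U f.
Proof.
move=> h z0 /h[c [d d0 hc]]; exists c; apply/nbhs_ballP.
exists d%:C; first by rewrite /= ltcR.
move=> z /=; rewrite -ball_normE/= normcE ltcR => zd.
by apply: hc; rewrite -normc_opp opprB.
Qed.

Lemma cvg_geom_series (s a : R) : 0 <= s -> s < 1 ->
  cvgn (series (fun n => a * s ^+ n)).
Proof.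
move=> s0 s1; apply: (@is_cvg_geometric_series _ a s).
by rewrite ger0_norm.
Qed.

Lemma has_sum_laurent (b : nat -> R[i]) (C rho : R) (z : R[i]) :
  0 < rho -> (forall n, normc (b n) <= C * rho ^+ n) -> rho < normc z ->
  has_sum (fun n => b n / z ^+ n.+1) (csum (fun n => b n / z ^+ n.+1)).
Proof.
move=> rho0 bC rz; have z0 : 0 < normc z by exact: lt_trans rz.
apply: (@has_csum _ _ (fun n => C / normc z * (rho / normc z) ^+ n)).
  move=> n; rewrite normcM normcV normcX exprS invfM expr_div_n.
  have -> : C / normc z * (rho ^+ n / normc z ^+ n) =
    C * rho ^+ n * ((normc z)^-1 / normc z ^+ n) by ring.
  by apply: ler_wpM2r (bC n); rewrite mulr_ge0 ?invr_ge0 ?exprn_ge0 ?normc_ge0.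
by apply: cvg_geom_series; rewrite ?divr_ge0 ?ltW// ltr_pdivrMr// mul1r.
Qed.

(** Each [z ^- n.+1] is expanded at [z0] by the negative binomial series and the double series is
    exchanged. That the disk stays outside radius [rho] is part of the conclusion because the gluing
    needs it. *)
Lemma laurent_analytic (b : nat -> R[i]) (C rho : R) (z0 : R[i]) :
  0 < rho -> (forall n, normc (b n) <= C * rho ^+ n) -> rho < normc z0 ->
  exists c : nat -> R[i], exists2 d : R, 0 < d & forall z, normc (z - z0) < d ->
      rho < normc z /\
      has_sum (fun n => c n * (z - z0) ^+ n) (csum (fun n => b n / z ^+ n.+1)).
Proof.
move=> rho0 bC; set d := normc z0 => rd.
have d0 : 0 < d by exact: lt_trans rd.
have z0n : z0 != 0 by rewrite -normc_gt0.
have C0 : 0 <= C.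
  by have := bC 0%N; rewrite expr0 mulr1; apply: le_trans; exact: normc_ge0.
(* Relative to [normc z0], [s] is the inner radius and [t] the radius of the new disk; [s + t < 1]
   gives both convergence and distance from the inner circle. *)
pose s := rho / d; pose t := (1 - s) / 2.
have s0 : 0 < s by rewrite divr_gt0.
have s1 : s < 1 by rewrite /s ltr_pdivrMr// mul1r.
have t0 : 0 < t by rewrite divr_gt0// subr_gt0.
have st1 : s + t < 1 by rewrite /t; lra.
have st0 : 0 < s + t by exact: addr_gt0.
have td : t * d + rho < d.
  have -> : rho = s * d by rewrite /s -mulrA mulVf ?mulr1// gt_eqF.
  by rewrite -mulrDl addrC gtr_pMl.
have sX n : s ^+ n = rho ^+ n / d ^+ n by rewrite /s expr_div_n.
clearbody s t.
(* The coefficient of [h ^+ m] in [b n / (z0 + h) ^+ n.+1]. *)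
pose w n m := b n * 'C(n + m, n)%:R * (-1) ^+ m / z0 ^+ (n.+1 + m).
have wle n m x : 0 <= x -> x <= t * d ->
    normc (w n m) * x ^+ m <= C / d * (s + t) ^+ n * (s + t) ^+ m.
  move=> x0 xtd; rewrite /w !normcM normcV !normcX normcN normc1 expr1n mulr1.
  rewrite -(rmorph_nat (real_complex R)) normc_real ger0_norm// -/d.
  apply: (@le_trans _ _ (C * rho ^+ n * 'C(n + m, n)%:R / d ^+ (n.+1 + m) *
                         (t * d) ^+ m)).
    apply: ler_pM; rewrite ?exprn_ge0//.
    - by rewrite !mulr_ge0 ?normc_ge0 ?invr_ge0 ?exprn_ge0 ?(ltW d0).
    - by rewrite ler_wpM2r ?invr_ge0 ?exprn_ge0 ?(ltW d0)// ler_wpM2r.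
    - by apply: lerXn2r; rewrite ?nnegrE// (le_trans x0).
  have -> : C * rho ^+ n * 'C(n + m, n)%:R / d ^+ (n.+1 + m) * (t * d) ^+ m =
     C / d * ('C(n + m, n)%:R * t ^+ m * s ^+ n).
    rewrite sX exprMn exprD exprS.
    by field; rewrite expf_neq0 ?expf_neq0 ?gt_eqF.
  rewrite -[leRHS]mulrA -exprD ler_wpM2l ?divr_ge0 ?(ltW d0)// addrC.
  by apply: bin_le_expr; exact: ltW.
exists (fun m => csum (fun n => w n m)); exists (t * d); first exact: mulr_gt0.
move=> z; set h := z - z0 => hd.
have zE : z = z0 + h by rewrite /h addrC subrK.
have rz : rho < normc z.
  have : d <= normc z + normc h.
    by rewrite /d [X in normc X <= _](_ : z0 = z - h) ?ler_normcB// zE addrK.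
  by move=> dz; rewrite -(ltrD2r (normc h)); apply: lt_le_trans dz; lra.
split=> //.
have zn : z != 0 by rewrite -normc_gt0; exact: lt_trans rz.
apply: (@has_sum_exchange _ (fun n m => w n m * h ^+ m)
   (fun n => C / d * (s + t) ^+ n) (fun m => (s + t) ^+ m)
   (fun n => b n / z ^+ n.+1)).
- by move=> n; rewrite mulr_ge0 ?divr_ge0 ?exprn_ge0 ?(ltW d0) ?(ltW st0).
- by move=> n; rewrite exprn_ge0 ?(ltW st0).
- by move=> n m; rewrite normcM normcX; apply: wle; [exact: normc_ge0|exact: ltW].
- by apply: cvg_geom_series => //; exact: ltW.
- rewrite (_ : series _ = series (fun n => 1 * (s + t) ^+ n)).
    by apply: cvg_geom_series => //; exact: ltW.
  by congr series; apply/funext => n; rewrite mul1r.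
- move=> n; have hz : normc (- h / z0) < 1.
    rewrite normcM normc_opp normcV -/d ltr_pdivrMr// mul1r.
    by apply: lt_trans hd _; lra.
  have := has_sumZ (c := b n / z0 ^+ n.+1) (has_sum_neg_bin (n := n) hz).
  congr has_sum; last first.
    rewrite -mulrA; congr (_ * _); rewrite -exprVn -exprMn -exprVn; congr (_ ^+ _).
    rewrite mulNr opprK -invfM; congr (_^-1); rewrite zE; field.
    exact: z0n.
  apply/funext => m; rewrite /w exprD exprMn -[- h]mulN1r exprMn exprVn.
  by field; rewrite !expf_neq0.
- exact: has_sum_laurent rz.
- move=> m; rewrite (_ : (fun n => _) = fun n => h ^+ m * w n m); last first.
    by apply/funext => n; rewrite mulrC.
  rewrite mulrC; apply: has_sumZ.
  (* Taking [wle] at the full radius [t * d] bounds the coefficients [w n m] themselves, in the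
     manner of Cauchy's estimates. *)
  apply: (@has_csum _ _ (fun n => C / d * (s + t) ^+ m / (t * d) ^+ m
     * (s + t) ^+ n)); last by apply: cvg_geom_series => //; exact: ltW.
  move=> n; rewrite mulrAC ler_pdivlMr ?exprn_gt0 ?mulr_gt0//.
  apply: le_trans (wle n m (t * d) _ _) _ => //; first by rewrite mulr_ge0// ltW.
  by rewrite mulrAC.
Qed.

End LaurentAnalytic.

(** * Integrals of complex-valued functions *)

Section ComplexIntegral.
Context (d : measure_display) (T : measurableType d) (R : realType).
Variables (mu : {measure set T -> \bar R}) (D : set T).
Hypothesis mD : measurable D.
Implicit Types (f g : T -> R[i]) (h : T -> R).

Definition cintegral f : R[i] :=
  Rintegral mu D (fun x => complex.Re (f x)) +i*
  Rintegral mu D (fun x => complex.Im (f x)).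

Definition cintegrable f : Prop :=
  mu.-integrable D (EFin \o (fun x => complex.Re (f x))) /\
  mu.-integrable D (EFin \o (fun x => complex.Im (f x))).

Definition cmeasurable f : Prop :=
  measurable_fun D (fun x => complex.Re (f x)) /\
  measurable_fun D (fun x => complex.Im (f x)).

Lemma eq_cintegral f g : (forall x, D x -> f x = g x) ->
  cintegral f = cintegral g.
Proof.
move=> fg; rewrite /cintegral; congr (_ +i* _);
  by apply: eq_Rintegral => x; rewrite inE => Dx; rewrite fg.
Qed.

Lemma cmeasurableD f g : cmeasurable f -> cmeasurable g ->
  cmeasurable (fun x => f x + g x).
Proof.
move=> [fr fi] [gr gi]; split.
  by under eq_fun do rewrite ReD; exact: measurable_funD.
by under eq_fun do rewrite ImD; exact: measurable_funD.
Qed.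

Lemma cmeasurableM f g : cmeasurable f -> cmeasurable g ->
  cmeasurable (fun x => f x * g x).
Proof.
move=> [fr fi] [gr gi]; split.
  by under eq_fun do rewrite ReM; apply: measurable_funB;
    exact: measurable_funM.
by under eq_fun do rewrite ImM; apply: measurable_funD;
  exact: measurable_funM.
Qed.

Lemma cmeasurable_cst (c : R[i]) : cmeasurable (fun=> c).
Proof. by split; exact: measurable_cst. Qed.

Lemma cmeasurableX f n : cmeasurable f -> cmeasurable (fun x => f x ^+ n).
Proof.
move=> mf; elim: n => [|n IH]; first exact: cmeasurable_cst.
by under eq_fun do rewrite exprS; exact: cmeasurableM.
Qed.

Lemma cmeasurable_real h : measurable_fun D h -> cmeasurable (fun x => (h x)%:C).
Proof. by move=> mh; split => //=; exact: measurable_cst. Qed.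

Lemma cintegrable_bound f h : cmeasurable f ->
  mu.-integrable D (EFin \o h) -> (forall x, D x -> normc (f x) <= h x) ->
  cintegrable f.
Proof.
move=> [mr mi] ih fh; split; apply: (le_integrable mD _ _ ih).
- exact/measurable_EFinP.
- move=> x Dx /=; rewrite lee_fin; apply: le_trans (normRe_le _) _.
  by apply: le_trans (fh x Dx) _; exact: ler_norm.
- exact/measurable_EFinP.
- move=> x Dx /=; rewrite lee_fin; apply: le_trans (normIm_le _) _.
  by apply: le_trans (fh x Dx) _; exact: ler_norm.
Qed.

(** The factor 2 comes from treating the two parts separately; it is harmless, since the bound
    serves only for null errors and for orders of growth. *)
Lemma normc_cintegral_le f h : cintegrable f ->
  mu.-integrable D (EFin \o h) -> (forall x, D x -> normc (f x) <= h x) ->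
  normc (cintegral f) <= 2 * Rintegral mu D h.
Proof.
move=> [ir ii] ih fh; apply: le_trans (normc_le_ReIm _) _ => /=.
have absi (k : T -> R) : mu.-integrable D (EFin \o k) ->
    mu.-integrable D (EFin \o (fun x => `|k x|)).
  by move=> ik; exact: (integrable_abse ik).
rewrite mulrDl !mul1r; apply: lerD.
  apply: le_trans (le_normr_Rintegral mD ir) _.
  apply: le_Rintegral => //; first exact: absi.
  by move=> x Dx; apply: le_trans (normRe_le _) _; exact: fh.
apply: le_trans (le_normr_Rintegral mD ii) _.
apply: le_Rintegral => //; first exact: absi.
by move=> x Dx; apply: le_trans (normIm_le _) _; exact: fh.
Qed.

Lemma cintegrableD f g : cintegrable f -> cintegrable g ->
  cintegrable (fun x => f x + g x).
Proof.
move=> [fr fi] [gr gi]; split.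
  rewrite (_ : EFin \o _ = (EFin \o (fun x => complex.Re (f x))) \+
                           (EFin \o (fun x => complex.Re (g x)))).
    exact: integrableD.
  by apply/funext => x /=; rewrite ReD.
rewrite (_ : EFin \o _ = (EFin \o (fun x => complex.Im (f x))) \+
                         (EFin \o (fun x => complex.Im (g x)))).
  exact: integrableD.
by apply/funext => x /=; rewrite ImD.
Qed.

Lemma cintegralD f g : cintegrable f -> cintegrable g ->
  cintegral (fun x => f x + g x) = cintegral f + cintegral g.
Proof.
move=> [fr fi] [gr gi]; rewrite /cintegral.
under eq_Rintegral do rewrite ReD.
under [X in _ +i* X]eq_Rintegral do rewrite ImD.
by rewrite !RintegralD.
Qed.

Lemma integrable_linear (a b : R) (h k : T -> R) :
  mu.-integrable D (EFin \o h) -> mu.-integrable D (EFin \o k) ->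
  mu.-integrable D (EFin \o (fun x => a * h x + b * k x)).
Proof.
move=> ih ik.
rewrite (_ : EFin \o _ = (fun x => a%:E * (EFin \o h) x)%E \+
                         (fun x => b%:E * (EFin \o k) x)%E); last first.
  by apply/funext => x /=; rewrite EFinD !EFinM.
by apply: integrableD => //; exact: integrableZl.
Qed.

Lemma Rintegral_linear (a b : R) (h k : T -> R) :
  mu.-integrable D (EFin \o h) -> mu.-integrable D (EFin \o k) ->
  Rintegral mu D (fun x => a * h x + b * k x) =
  a * Rintegral mu D h + b * Rintegral mu D k.
Proof.
move=> ih ik.
have iZ (c : R) (l : T -> R) : mu.-integrable D (EFin \o l) ->
    mu.-integrable D (EFin \o (fun x => c * l x)).
  move=> il; rewrite (_ : EFin \o _ = (fun x => c%:E * (EFin \o l) x)%E).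
    exact: integrableZl.
  by apply/funext => x /=; rewrite EFinM.
rewrite RintegralD//; [|exact: iZ|exact: iZ].
by rewrite !RintegralZl.
Qed.

Lemma cintegrableZ (c : R[i]) f : cintegrable f ->
  cintegrable (fun x => c * f x).
Proof.
move=> [fr fi]; split.
  by under eq_fun do rewrite ReM -mulNr; exact: integrable_linear.
by under eq_fun do rewrite ImM; exact: integrable_linear.
Qed.

Lemma cintegralZ (c : R[i]) f : cintegrable f ->
  cintegral (fun x => c * f x) = c * cintegral f.
Proof.
move=> [fr fi]; rewrite /cintegral.
under eq_Rintegral do rewrite ReM -mulNr.
under [X in _ +i* X]eq_Rintegral do rewrite ImM.
rewrite !Rintegral_linear//; apply/eqP; rewrite eq_complex/=.
by rewrite ReM ImM/= mulNr !eqxx.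
Qed.

Lemma cintegral_sum (F : nat -> T -> R[i]) n : (forall i, cintegrable (F i)) ->
  cintegrable (fun x => \sum_(0 <= i < n) F i x) /\
  cintegral (fun x => \sum_(0 <= i < n) F i x) =
  \sum_(0 <= i < n) cintegral (F i).
Proof.
move=> iF; elim: n => [|n [IH IHE]].
  (* The empty sum is written as a multiple of [F 0%N], from which it inherits integrability. *)
  have E0 : (fun x => \sum_(0 <= i < 0) F i x) = fun x => 0 * F 0%N x.
    by apply/funext => x; rewrite big_geq// mul0r.
  by rewrite E0 cintegralZ// mul0r big_geq//; split => //; exact: cintegrableZ.
have E : (fun x => \sum_(0 <= i < n.+1) F i x) =
         fun x => \sum_(0 <= i < n) F i x + F n x.
  by apply/funext => x; rewrite big_nat_recr.
by rewrite E cintegralD// big_nat_recr//= IHE; split => //; exact: cintegrableD.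
Qed.

End ComplexIntegral.

(** * The exterior of an interval and the Cauchy kernel *)

(** Inversion is continuous only off 0, so the composition goes through that open set. *)
Lemma measurable_fun_inv (d : measure_display) (T : measurableType d)
    (R : realType) (D : set T) (f : T -> R) :
  (forall x, D x -> f x != 0) -> measurable_fun D f ->
  measurable_fun D (fun x => (f x)^-1).
Proof.
move=> f0 mf; set E := [set x : R | x != 0].
have oE : open E := @open_neq _ 0.
have mV : measurable_fun E (fun x : R => x^-1).
  apply: open_continuous_measurable_fun => // x; rewrite inE /= => x0.
  exact: inv_continuous.
have mE : measurable E by exact: open_measurable.
apply: (measurable_comp mE _ mV mf).
by move=> _ [x Dx <-] /=; exact: f0.
Qed.

Section Exterior.
Variables (R : realType) (rho : R).
Hypothesis rho0 : 0 < rho.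
Local Notation mu := (@lebesgue_measure R).

Definition exterior : set R := [set x | rho <= `|x|].

Lemma exteriorE : exterior = `]-oo, (- rho)] `|` `[rho, +oo[.
Proof.
apply/seteqP; split=> x; rewrite /exterior /= !in_itv/= andbT.
  by rewrite ler_normr => /orP[h|h]; [right|left; rewrite lerNr].
by rewrite ler_normr => -[h|->//]; rewrite lerNr h orbT.
Qed.

Lemma measurable_exterior : measurable (exterior : set (measurableTypeR R)).
Proof. by rewrite exteriorE; apply: measurableU; exact: measurable_itv. Qed.

Lemma exterior_neq0 x : exterior x -> x != 0.
Proof. by rewrite /exterior/= -normr_gt0; exact: lt_le_trans. Qed.

Lemma integrableT_oneDsqrV :
  mu.-integrable setT (EFin \o (fun x : R => (1 + x ^+ 2)^-1)).
Proof.
have c1 : continuous (fun x : R => (1 + x ^+ 2)^-1) := continuous_oneDsqrV.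
have p0 (x : R) : 0 <= (1 + x ^+ 2)^-1 by rewrite invr_ge0 addr_ge0// sqr_ge0.
apply/integrableP; split.
  by apply/measurable_EFinP; exact: continuous_measurable_fun.
under eq_integral do rewrite /= ger0_norm//.
rewrite ge0_symfun_integralT//; last by move=> x /=; rewrite sqrrN.
by rewrite -set_itvcy integral0y_oneDsqr -EFinM ltry.
Qed.

Lemma integrable_exterior_sqrV :
  mu.-integrable exterior (EFin \o (fun x : R => x ^- 2)).
Proof.
(* The comparison function is [(1 + x ^+ 2)^-1], integrable on the line; the ratio
   [(1 + x ^+ 2) / x ^+ 2 = 1 + x ^- 2] is at most [c] on the exterior. *)
pose c := 1 + rho ^- 2.
have i1 : mu.-integrable exterior
    (EFin \o (fun x : R => c * (1 + x ^+ 2)^-1)).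
  have i0 := integrableS measurableT measurable_exterior (@subsetT _ _)
    integrableT_oneDsqrV.
  exact: (integrableZl measurable_exterior c i0).
apply: le_integrable i1; first exact: measurable_exterior.
  apply/measurable_EFinP; apply: measurable_fun_inv.
    by move=> x /exterior_neq0 x0; rewrite expf_neq0.
  by apply: measurable_funX; exact: measurable_id.
move=> x Dx /=; rewrite lee_fin.
have x0 := exterior_neq0 Dx.
have x2 : 0 < x ^+ 2 by rewrite exprn_even_gt0.
have c0 : 0 <= c by rewrite addr_ge0// invr_ge0 exprn_ge0// ltW.
rewrite ger0_norm ?invr_ge0 ?(ltW x2)// ger0_norm; last first.
  by rewrite mulr_ge0// invr_ge0 addr_ge0// ltW.
rewrite ler_pdivlMr ?addr_gt0// mulrDr mulr1 mulVf ?gt_eqF// addrC lerD2l.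
rewrite lef_pV2 ?posrE ?x2 ?exprn_gt0//.
by rewrite -[leRHS]real_normK ?num_real// lerXn2r// nnegrE ltW.
Qed.

Lemma exterior_expr_le x n : exterior x -> `|x| ^- n.+2 <= rho ^- n * x ^- 2.
Proof.
move=> Dx; have x0 : 0 < `|x| by rewrite normr_gt0 exterior_neq0.
rewrite -(real_normK (num_real x)) -addn2 exprD invfM ler_wpM2r//.
by rewrite lef_pV2 ?posrE ?exprn_gt0// lerXn2r// nnegrE ltW.
Qed.

End Exterior.

Section Kernel.
Variables (R : realType) (z : R[i]).
Hypothesis z0 : complex.Im z != 0.
Let u := complex.Re z.
Let v := complex.Im z.

(** The squared modulus of [z - x]. *)
Definition qker (x : R) : R := (u - x) ^+ 2 + v ^+ 2.
Definition kernel (x : R) : R[i] := (z - x%:C)^-1.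

Lemma qker_gt0 x : 0 < qker x.
Proof. by rewrite ltr_wpDl ?sqr_ge0// exprn_even_gt0. Qed.

Lemma Re_kernel x : complex.Re (kernel x) = (u - x) / qker x.
Proof.
rewrite /kernel /qker /u /v; case: z => a b /=.
by rewrite oppr0 addr0.
Qed.

Lemma Im_kernel x : complex.Im (kernel x) = - v / qker x.
Proof.
rewrite /kernel /qker /u /v; case: z => a b /=.
by rewrite oppr0 addr0 mulNr.
Qed.

Lemma kernel_neq0 (x : R) : z - x%:C != 0.
Proof.
apply: contra_neq z0 => /eqP; rewrite subr_eq0 => /eqP ->.
by [].
Qed.

Lemma normc_kernel_le x : normc (kernel x) <= `|v|^-1.
Proof.
rewrite normcV lef_pV2 ?posrE ?normr_gt0// ?normc_gt0 ?kernel_neq0//.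
by apply: le_trans (normIm_le _); rewrite ImB/= subr0.
Qed.

(** From [|x| <= |z - x| + |z|] and [|v| <= |z - x|]. The kernel thus gains one power of [x], which
    makes [x^-1 / (z - x)] comparable with [x ^- 2]. *)
Lemma norm_kernel_le x : `|x| * normc (kernel x) <= 1 + normc z / `|v|.
Proof.
have n0 : 0 < normc (z - x%:C) by rewrite normc_gt0 kernel_neq0.
have n1 := normc_kernel_le x; rewrite /kernel normcV in n1 *.
rewrite ler_pdivrMr// mulrDl mul1r.
apply: (@le_trans _ _ (normc (z - x%:C) + normc z)).
  rewrite -normc_real [X in normc X <= _](_ : _ = z - (z - x%:C)).
    by rewrite [leRHS]addrC ler_normcB.
  by rewrite subKr.
rewrite lerD2l -mulrA ler_peMr ?normc_ge0//.
by rewrite mulrC -ler_pdivrMl// mulr1.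
Qed.

Lemma continuous_qker : continuous qker.
Proof.
move=> x; apply: cvgD; last exact: cvg_cst.
by apply: cvgM; apply: cvgB; (exact: cvg_cst || exact: cvg_id).
Qed.

Lemma continuous_Re_kernel : continuous (fun x => complex.Re (kernel x)).
Proof.
under eq_fun do rewrite Re_kernel.
move=> x; apply: cvgM; first by apply: cvgB; (exact: cvg_cst || exact: cvg_id).
by apply: cvgV; [rewrite gt_eqF ?qker_gt0|exact: continuous_qker].
Qed.

Lemma continuous_Im_kernel : continuous (fun x => complex.Im (kernel x)).
Proof.
under eq_fun do rewrite Im_kernel.
move=> x; apply: cvgM; first exact: cvg_cst.
by apply: cvgV; [rewrite gt_eqF ?qker_gt0|exact: continuous_qker].
Qed.

Lemma cmeasurable_kernel (D : set (measurableTypeR R)) : measurable D ->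
  cmeasurable D kernel.
Proof.
move=> mD; split; apply: measurable_funTS; apply: continuous_measurable_fun.
  exact: continuous_Re_kernel.
exact: continuous_Im_kernel.
Qed.

End Kernel.

(** * Integration over the exterior by antiderivatives *)

Section ExteriorFTC.
Variables (R : realType) (rho : R).
Hypothesis rho0 : 0 < rho.
Local Notation mu := (@lebesgue_measure R).

Lemma Rintegral_FTC (f F : R -> R) (a b : R) : a < b ->
  (forall x, a <= x <= b -> is_derive x 1 F (f x)) ->
  (forall x, a <= x <= b -> {for x, continuous f}) ->
  Rintegral mu `[a, b] f = F b - F a.
Proof.
move=> ab dF cf; rewrite /Rintegral (@continuous_FTC2 _ f F) ?EFinN//.
- apply: continuous_in_subspaceT => x; rewrite inE/= in_itv/=; exact: cf.
- have cF x : a <= x <= b -> {for x, continuous F}.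
    move=> /dF dFx; apply: differentiable_continuous.
    by apply/derivable1_diffP; exact: ex_derive.
  split.
  + by move=> x /subset_itv_oo_cc; rewrite in_itv/= => /dF dFx; exact: ex_derive.
  + by apply: cvg_at_right_filter; apply: cF; rewrite lexx ltW.
  + by apply: cvg_at_left_filter; apply: cF; rewrite lexx ltW.
- move=> x /subset_itv_oo_cc; rewrite in_itv/= => /dF dFx.
  by rewrite derive1E; exact: derive_val.
Qed.

Lemma Rintegral_exterior_cap (f F : R -> R) (N : R) : rho < N ->
  mu.-integrable (exterior rho) (EFin \o f) ->
  (forall x, exterior rho x -> is_derive x 1 F (f x)) ->
  (forall x, exterior rho x -> {for x, continuous f}) ->
  Rintegral mu (exterior rho `&` `[- N, N]) f =
  (F N - F (- N)) - (F rho - F (- rho)).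
Proof.
move=> rN fi dF cf.
have rN' : - rho <= N.
  by rewrite (@le_trans _ _ 0) ?oppr_le0 ?(ltW rho0)// ltW// (lt_trans rho0).
have subr x : rho <= x <= N -> exterior rho x.
  by move=> /andP[rx _]; rewrite /exterior/= ler_normr rx.
have subl x : - N <= x <= - rho -> exterior rho x.
  by move=> /andP[_ rx]; rewrite /exterior/= ler_normr [_ <= - x]lerNr rx orbT.
have -> : exterior rho `&` `[- N, N] = `[- N, - rho] `|` `[rho, N].
  rewrite exteriorE; apply/seteqP; split => x /=; rewrite !in_itv/= ?andbT.
    by move=> [[h|h] /andP[h1 h2]]; [left|right]; apply/andP.
  move=> [|] /andP[h1 h2]; split; [by left| |by right|]; apply/andP; split=> //.
    exact: (le_trans h2).
  by apply: le_trans h1; rewrite lerNl.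
rewrite Rintegral_setU; last 4 first.
- exact: measurable_itv.
- exact: measurable_itv.
- apply: integrableS fi; first exact: measurable_exterior.
    by apply: measurableU; exact: measurable_itv.
  by move=> x /= []; rewrite in_itv/=; [exact: subl|exact: subr].
- apply/disj_setPS => x /= []; rewrite !in_itv/= => /andP[_ h1] /andP[h2 _].
  by have := le_trans h2 h1; rewrite leNgt gtrN.
have -> : Rintegral mu `[- N, - rho] f = F (- rho) - F (- N).
  apply: Rintegral_FTC => [|x /subl xD|x /subl]; [by rewrite ltrN2| |exact: cf].
  exact: dF.
have -> : Rintegral mu `[rho, N] f = F N - F rho.
  by apply: Rintegral_FTC => [//|x /subr xD|x /subr]; [exact: dF|exact: cf].
by ring.
Qed.

(** As [f] is assumed integrable, dominated convergence over symmetric cut-offs gives the integral,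
    and only the difference of [F] at the two ends has to converge. *)
Lemma Rintegral_exterior_FTC (f F : R -> R) (l : R) :
  mu.-integrable (exterior rho) (EFin \o f) ->
  (forall x, exterior rho x -> is_derive x 1 F (f x)) ->
  (forall x, exterior rho x -> {for x, continuous f}) ->
  (fun n : nat => F n%:R - F (- n%:R)) @ \oo --> l ->
  Rintegral mu (exterior rho) f = l - (F rho - F (- rho)).
Proof.
move=> fi dF cf Fl.
have mD := @measurable_exterior R rho.
pose I (n : nat) : set (measurableTypeR R) := `[- n%:R, n%:R]%classic.
have mI n : measurable (I n) by exact: measurable_itv.
have mf := measurable_int mu fi.
have [] := @dominated_convergence _ _ _ mu _ mD
  (fun n => (EFin \o f) \_ (I n)) (EFin \o f) (abse \o (EFin \o f)).
- move=> n; apply/(measurable_restrict _ (mI n) mD).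
  by apply: measurable_funS mf => //; exact: subIsetl.
- exact: mf.
- apply/aeW => x Dx; apply: cvg_near_cst.
  near=> n; rewrite patchE ifT// inE /I/= in_itv/= -ler_norml.
  by near: n; exact: nbhs_infty_ger.
- exact: integrable_abse.
- apply/aeW => x n Dx; rewrite patchE; case: ifP => _ /=; first exact: lexx.
  by rewrite normr0 lee_fin.
move=> _ _ cvgI.
have fin : (\int[mu]_(x in exterior rho) (EFin \o f) x)%E \is a fin_num.
  exact: integrable_fin_num.
have : (fun n : nat => ((F n%:R - F (- n%:R)) - (F rho - F (- rho)))%:E)
    @ \oo --> (\int[mu]_(x in exterior rho) (EFin \o f) x)%E.
  apply: cvg_trans cvgI; apply: near_eq_cvg; near=> n.
  have rn : rho < n%:R.
    by near: n; exact: nbhs_infty_gtr.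
  rewrite /= -integral_mkcondr -(Rintegral_exterior_cap rn fi dF cf).
  rewrite /Rintegral fineK//; apply: integrable_fin_num.
    by apply: measurableI => //; exact: mI.
  by apply: integrableS fi => //; exact: measurableI.
rewrite -(fineK fin) => /fine_cvgP[_ h].
apply: (cvg_unique _ h) => //=.
by apply: cvgB => //; exact: cvg_cst.
Unshelve. all: by end_near. Qed.

End ExteriorFTC.

(** * The logarithm along the real line *)

Section LogKernel.
Variables (R : realType) (z : R[i]).
Hypothesis z0 : complex.Im z != 0.
Let u := complex.Re z.
Let v := complex.Im z.

(* Branch of [- log (z - x)] along the real line, an antiderivative of [kernel z]. *)
Definition logker (x : R) : R[i] :=
  (- (ln (qker z x) / 2)) +i* (- atan ((x - u) / v)).

Lemma is_derive_qker (x : R) : is_derive x 1 (qker z) (- (2 * (u - x))).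
Proof.
have h1 : is_derive x 1 (fun y : R => u - y) (-1).
  have -> : (-1 : R) = 0 - 1 by rewrite sub0r.
  exact: is_deriveB.
have h2 := is_deriveX 2 h1.
have h3 := is_deriveD h2 (@is_derive_cst R R^o R^o (v ^+ 2) x 1).
rewrite (_ : - (2 * (u - x)) = (2%:R * (u - x) ^+ 1) *: -1 + 0); last first.
  by rewrite addr0 /GRing.scale/= expr1; ring.
exact: h3.
Qed.

Lemma is_derive_Re_logker (x : R) :
  is_derive x 1 (fun y => complex.Re (logker y)) (complex.Re (kernel z x)).
Proof.
have q0 := qker_gt0 z0 x.
have h1 := is_derive1_comp (is_derive1_ln q0) (is_derive_qker x).
have h2 := is_deriveZ (- 2^-1) h1.
rewrite Re_kernel.
rewrite (_ : (_ - _) / _ = - 2^-1 *: ((qker z x)^-1 * - (2 * (u - x)))); last first.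
  by rewrite /GRing.scale/= -/u; field; rewrite gt_eqF.
rewrite (_ : (fun y => _) = - 2^-1 \*: (@ln R \o qker z)).
  exact: h2.
by apply/funext => y /=; rewrite /GRing.scale/=; ring.
Qed.

Lemma is_derive_Im_logker (x : R) :
  is_derive x 1 (fun y => complex.Im (logker y)) (complex.Im (kernel z x)).
Proof.
have q0 := qker_gt0 z0 x.
have h1 : is_derive x 1 (fun y : R => v^-1 *: (y - u)) (v^-1 *: (1 - 0)).
  by apply: is_deriveZ; exact: is_deriveB.
have h2 := is_deriveN (is_derive1_comp (is_derive1_atan _) h1).
rewrite Im_kernel.
rewrite (_ : - _ / _ =
   - ((1 + (v^-1 *: (x - u)) ^+ 2)^-1 * (v^-1 *: (1 - 0)))); last first.
  rewrite /GRing.scale/= -/v subr0 mulr1 -invfM mulNr; congr (- _).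
  apply: (@mulfI _ v^-1); first by rewrite invr_eq0.
  rewrite mulrA mulVf// mul1r -invfM; congr (_^-1).
  by rewrite /qker -/u -/v; field.
rewrite (_ : (fun y => _) = - (@atan R \o (fun y : R => v^-1 *: (y - u)))).
  exact: h2.
by apply/funext => y /=; rewrite /GRing.scale/= [_ / _]mulrC.
Qed.

(** Up to the constant [logker 0], the Taylor remainder of [logker] at 0. Its derivative is the
    geometric remainder in [kernel_partial_sum]. *)
Let remainder N (x : R) : R[i] :=
  logker x - \sum_(0 <= k < N) (x%:C / z) ^+ k.+1 / k.+1%:R.

Lemma kernel_partial_sum N (x : R) :
  kernel z x - \sum_(0 <= k < N) x%:C ^+ k / z ^+ k.+1 =
  (x%:C / z) ^+ N * kernel z x.
Proof.
have zn : z != 0 by apply: contra_neq z0 => ->.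
have kn := kernel_neq0 z0 x; rewrite /kernel.
elim: N => [|N IH]; first by rewrite big_geq// subr0 mul1r.
rewrite big_nat_recr//= opprD addrA IH [in RHS]exprS !expr_div_n exprS.
by field; rewrite kn expf_neq0// zn.
Qed.

Lemma cnat_real n : (n%:R : R[i]) = (n%:R : R)%:C.
Proof. by rewrite rmorph_nat. Qed.

Lemma remainder_term (x : R) k : (x%:C / z) ^+ k.+1 / k.+1%:R =
  (x ^+ k.+1 / k.+1%:R)%:C * (z^-1) ^+ k.+1.
Proof.
by rewrite cnat_real rmorphM rmorphXn fmorphV expr_div_n exprVn/= mulrAC.
Qed.

Lemma Re_scale (a : R) (w : R[i]) : complex.Re (a%:C * w) = a * complex.Re w.
Proof. by rewrite ReM/= mul0r subr0. Qed.

Lemma Im_scale (a : R) (w : R[i]) : complex.Im (a%:C * w) = a * complex.Im w.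
Proof. by rewrite ImM/= mul0r addr0. Qed.

Lemma is_derive_powsum (c : nat -> R) N (x : R) :
  is_derive x 1 (fun y : R => \sum_(0 <= k < N) (y ^+ k.+1 / k.+1%:R) * c k)
    (\sum_(0 <= k < N) x ^+ k * c k).
Proof.
elim: N => [|N IH].
  under eq_fun do rewrite big_geq//; rewrite big_geq//.
  exact: is_derive_cst.
under eq_fun do rewrite big_nat_recr//=; rewrite big_nat_recr//=.
apply: is_deriveD.
have h := is_deriveZ (c N / N.+1%:R) (is_deriveX N.+1 (@is_derive_id R R^o x 1)).
rewrite (_ : x ^+ N * c N = (c N / N.+1%:R) *: ((N.+1%:R * x ^+ N) *: 1)); last first.
  by rewrite /GRing.scale/=; field.
rewrite (_ : (fun y => _) = (c N / N.+1%:R) \*: (id ^+ N.+1)).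
  exact: h.
by apply/funext => y; rewrite /= /GRing.scale/= exprfctE; ring.
Qed.

Lemma is_derive_Re_remainder N (x : R) :
  is_derive x 1 (fun y => complex.Re (remainder N y))
    (complex.Re ((x%:C / z) ^+ N * kernel z x)).
Proof.
rewrite -kernel_partial_sum ReB Re_sum.
under eq_bigr do rewrite -exprVn -rmorphXn Re_scale.
rewrite (_ : (fun y => _) = (fun y => complex.Re (logker y)) -
   (fun y : R => \sum_(0 <= k < N) (y ^+ k.+1 / k.+1%:R) * complex.Re (z^-1 ^+ k.+1))).
  by apply: is_deriveB; [exact: is_derive_Re_logker|exact: is_derive_powsum].
apply/funext => y; rewrite ReB Re_sum !fctE; congr (_ - _).
by apply: eq_bigr => k _; rewrite remainder_term Re_scale.
Qed.

Lemma is_derive_Im_remainder N (x : R) :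
  is_derive x 1 (fun y => complex.Im (remainder N y))
    (complex.Im ((x%:C / z) ^+ N * kernel z x)).
Proof.
rewrite -kernel_partial_sum ImB Im_sum.
under eq_bigr do rewrite -exprVn -rmorphXn Im_scale.
rewrite (_ : (fun y => _) = (fun y => complex.Im (logker y)) -
   (fun y : R => \sum_(0 <= k < N) (y ^+ k.+1 / k.+1%:R) * complex.Im (z^-1 ^+ k.+1))).
  by apply: is_deriveB; [exact: is_derive_Im_logker|exact: is_derive_powsum].
apply/funext => y; rewrite ImB Im_sum !fctE; congr (_ - _).
by apply: eq_bigr => k _; rewrite remainder_term Im_scale.
Qed.

(** Both signs of [t] are covered because the logarithmic series is evaluated at [rho] and at
    [- rho]. *)
Lemma MVT_bound (f df : R -> R) (t C : R) :
  (forall x : R, is_derive x 1 f (df x)) ->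
  (forall x, `|x| <= `|t| -> `|df x| <= C) -> `|f t - f 0| <= C * `|t|.
Proof.
move=> dfx dC.
have cf (a b : R) : {within `[a, b], continuous f}.
  apply: continuous_subspaceT => x; apply: differentiable_continuous.
  by apply/derivable1_diffP; apply: ex_derive.
have [t0|t0] := leP 0 t.
  have [c] := @MVT_segment _ f df 0 t t0 (fun x _ => dfx x) (cf _ _).
  rewrite in_itv/= => /andP[c0 ct] ->; rewrite subr0 normrM ler_wpM2r//.
  by apply: dC; rewrite !ger0_norm.
have [c] := @MVT_segment _ f df t 0 (ltW t0) (fun x _ => dfx x) (cf _ _).
rewrite in_itv/= distrC => /andP[c0 ct] ->; rewrite sub0r normrM normrN ler_wpM2r//.
by apply: dC; rewrite !ler0_norm ?lerN2// ltW.
Qed.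

(** For [|x| <= |t|] the derivative of the remainder is at most [s ^+ N / |v|], with
    [s = |t| / |z| < 1]. The mean value inequality on each part gives an error of order [s ^+ N]. *)
Lemma has_sum_logker (t : R) : `|t| < normc z ->
  has_sum (fun k => (t%:C / z) ^+ k.+1 / k.+1%:R) (logker t - logker 0).
Proof.
move=> tz; set s := `|t| / normc z.
have z1 : 0 < normc z by exact: le_lt_trans tz.
have s1 : `|s| < 1.
  by rewrite ger0_norm ?divr_ge0 ?normc_ge0// ltr_pdivrMr// mul1r.
pose C := `|v|^-1 * `|t|.
apply: (@cvgc_bound _ _ _ (fun N => 2 * C * s ^+ N)).
  rewrite -[X in _ --> X](mulr0 (2 * C)).
  by apply: cvgM; [exact: cvg_cst|exact: cvg_expr].
apply: nearW => N.
have r0 : remainder N 0 = logker 0.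
  rewrite /remainder big1 ?subr0// => k _.
  by rewrite rmorph0 !mul0r exprS !mul0r.
have -> : series (fun k => (t%:C / z) ^+ k.+1 / k.+1%:R) N - (logker t - logker 0)
   = - (remainder N t - remainder N 0).
  by rewrite r0 /remainder /series/=; ring.
rewrite normc_opp; apply: le_trans (normc_le_ReIm _) _.
have dle (x : R) : `|x| <= `|t| ->
    normc ((x%:C / z) ^+ N * kernel z x) <= s ^+ N * `|v|^-1.
  move=> xt; rewrite normcM normcX normcM normcV normc_real.
  apply: ler_pM; rewrite ?exprn_ge0 ?divr_ge0 ?normc_ge0//.
    apply: lerXn2r; rewrite ?nnegrE ?divr_ge0 ?normc_ge0//.
    by rewrite ler_wpM2r// invr_ge0 normc_ge0.
  exact: normc_kernel_le.
rewrite (_ : 2 * C * s ^+ N = s ^+ N * `|v|^-1 * `|t| + s ^+ N * `|v|^-1 * `|t|).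
  rewrite ReB ImB; apply: lerD.
    apply: (MVT_bound (is_derive_Re_remainder N)) => x xt.
    by apply: le_trans (normRe_le _) _; exact: dle.
  apply: (MVT_bound (is_derive_Im_remainder N)) => x xt.
  by apply: le_trans (normIm_le _) _; exact: dle.
by rewrite /C; ring.
Qed.

End LogKernel.

(** * Principal value and expansion at infinity *)

Section PrincipalValue.
Variables (R : realType) (rho : R) (z : R[i]).
Hypothesis rho0 : 0 < rho.
Hypothesis zm : complex.Im z < 0.
Local Notation mu := (@lebesgue_measure R).
Local Notation D := (exterior rho).
Let u := complex.Re z.
Let v := complex.Im z.
Let z0 : complex.Im z != 0. Proof. by rewrite lt_eqF. Qed.
Let zn : z != 0. Proof. by apply: contraTneq zm => ->; rewrite ltxx. Qed.
Let mD := @measurable_exterior R rho.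

Definition kernel_bound : R := 1 + normc z / `|v|.

Lemma cvg_atan_affine (a w : R) : 0 < w ->
  (fun n : nat => atan ((n%:R + a) / w)) @ \oo --> (pi / 2 : R).
Proof.
move=> w0; apply: (cvg_comp (fun n : nat => (n%:R + a) / w) (@atan R)).
  2: exact: cvgy_atan.
apply/cvgryPge => A; near=> n.
rewrite ler_pdivlMr// -lerBlDr.
by near: n; exact: nbhs_infty_ger.
Unshelve. all: by end_near. Qed.

(** Here the sign of [Im z] enters: for [v < 0] the imaginary part increases from [- pi / 2] to
    [pi / 2] along the line. *)
Lemma cvg_Im_logker :
  (fun n : nat => complex.Im (logker z n%:R) - complex.Im (logker z (- n%:R)))
    @ \oo --> (pi : R).
Proof.
have w0 : 0 < - v by rewrite oppr_gt0.
have -> : (pi : R) = pi / 2 + pi / 2 by rewrite -splitr.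
rewrite (_ : (fun n => _) = (fun n : nat =>
  atan ((n%:R + - u) / - v) + atan ((n%:R + u) / - v))).
  by apply: cvgD; exact: cvg_atan_affine.
apply/funext => n /=; rewrite opprK invrN !mulrN !atanN; congr (_ + _).
by rewrite -atanN -mulNr opprD.
Qed.

(** Factoring [n ^+ 2] out of [qker] leaves a quantity tending to [e ^+ 2]. The cases [e = 1] and
    [e = -1] are the two ends of the line. *)
Lemma cvg_ln_qker (e : R) : e ^+ 2 = 1 ->
  (fun n : nat => ln ((n%:R : R) ^+ 2) / 2 - ln (qker z (e * n%:R)) / 2) @ \oo -->
  (0 : R).
Proof.
move=> e2.
have ninv : (fun n : nat => (n%:R : R)^-1) @ \oo --> (0 : R).
  apply/gtr0_cvgV0; last exact: cvgr_idn.
  near=> n; near: n; exact: nbhs_infty_gtr.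
have h : (fun n : nat => (u * n%:R^-1 - e) ^+ 2 + (v * n%:R^-1) ^+ 2) @ \oo -->
    (1 : R).
  rewrite [X in _ --> X](_ : 1 = (u * 0 - e) ^+ 2 + (v * 0) ^+ 2); last first.
    by rewrite !mulr0 sub0r sqrrN e2 expr0n/= addr0.
  have hu : (fun n : nat => u * n%:R^-1 - e) @ \oo --> u * 0 - e.
    by apply: cvgB; [apply: cvgM => //|]; exact: cvg_cst.
  have hv : (fun n : nat => v * n%:R^-1) @ \oo --> v * 0.
    by apply: cvgM => //; exact: cvg_cst.
  by apply: cvgD; apply: cvgM.
have hln := cvg_comp _ _ h (@continuous_ln _ _ (@ltr01 R)).
rewrite ln1 in hln.
have h0 : (fun n : nat => - 2^-1 *
    ln ((u * n%:R^-1 - e) ^+ 2 + (v * n%:R^-1) ^+ 2)) @ \oo --> (0 : R).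
  by rewrite -[X in _ --> X](mulr0 (- 2^-1)); apply: cvgM => //; exact: cvg_cst.
apply: cvg_trans h0.
apply: near_eq_cvg; near=> n.
have n0 : 0 < (n%:R : R) by near: n; exact: nbhs_infty_gtr.
have -> : qker z (e * n%:R) =
  n%:R ^+ 2 * ((u * n%:R^-1 - e) ^+ 2 + (v * n%:R^-1) ^+ 2).
  by rewrite /qker -/u -/v; field; rewrite gt_eqF.
rewrite /= lnM ?posrE ?exprn_gt0//; first by ring.
apply: ltr_wpDl; first exact: sqr_ge0.
by rewrite exprn_even_gt0//= mulf_neq0// invr_eq0 gt_eqF.
Unshelve. all: by end_near. Qed.

Definition kmono n (x : R) : R[i] := (x ^- n)%:C * kernel z x.

Lemma cmeasurable_powV n : cmeasurable (D : set (measurableTypeR R))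
  (fun x : R => (x ^- n)%:C).
Proof.
apply: cmeasurable_real; apply: measurable_fun_inv.
  by move=> x /(exterior_neq0 rho0) x0; rewrite expf_neq0.
by apply: measurable_funX; exact: measurable_id.
Qed.

Lemma cmeasurable_kmono n : cmeasurable (D : set (measurableTypeR R)) (kmono n).
Proof.
by apply: cmeasurableM; [exact: cmeasurable_powV|exact: cmeasurable_kernel].
Qed.

Lemma integrable_scale_sqrV (C : R) :
  mu.-integrable D (EFin \o (fun x : R => C * x ^- 2)).
Proof.
exact: (integrableZl mD C (integrable_exterior_sqrV rho0)).
Qed.

Lemma normc_powV_le n x : D x -> normc (x ^- n.+2)%:C <= rho ^- n * x ^- 2.
Proof.
move=> Dx; rewrite normc_real normfV normrX.
exact: exterior_expr_le.
Qed.

Lemma cintegrable_powV n : cintegrable mu D (fun x : R => (x ^- n.+2)%:C).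
Proof.
apply: (cintegrable_bound mD (cmeasurable_powV _) (integrable_scale_sqrV (rho ^- n))).
exact: normc_powV_le.
Qed.

(** The index starts at 1: the bare kernel decays only like [1 / |x|]. One power of [x] from the
    monomial and one from [norm_kernel_le] give the weight [x ^- 2]. *)
Lemma cintegrable_kmono n : cintegrable mu D (kmono n.+1).
Proof.
apply: (cintegrable_bound mD (cmeasurable_kmono _)
  (integrable_scale_sqrV (kernel_bound * rho ^- n))) => x Dx.
have x0 : 0 < `|x| by rewrite normr_gt0 (exterior_neq0 rho0).
rewrite /kmono normcM normc_real normfV normrX.
have -> : `|x| ^- n.+1 * normc (kernel z x) =
          (`|x| * normc (kernel z x)) * `|x| ^- n.+2.
  by rewrite [_ ^+ n.+2]exprS; field; rewrite expf_neq0 gt_eqF.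
rewrite -[leRHS]mulrA; apply: ler_pM.
- by rewrite mulr_ge0 ?normc_ge0.
- by rewrite invr_ge0 exprn_ge0.
- exact: norm_kernel_le.
- exact: exterior_expr_le.
Qed.

Lemma kmono_rec n x : x != 0 -> z * kmono n.+1 x = (x ^- n.+1)%:C + kmono n x.
Proof.
move=> x0; have kn := kernel_neq0 z0 x.
have xc : x%:C != 0 by apply: contra_neq x0 => -[].
rewrite /kmono /kernel !fmorphV !rmorphXn/= exprS.
by field; rewrite kn expf_neq0 ?xc.
Qed.

(** The integrand [z * kmono 1] is [x^-1 + kernel z x], integrable only as a sum. Its antiderivative
    contributes [pi] to the imaginary part at infinity and nothing to the real part. *)
Lemma cintegral_pv : z * cintegral mu D (kmono 1) =
  0 +i* pi - (logker z rho - logker z (- rho)).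
Proof.
pose f (x : R) := (x^-1)%:C + kernel z x.
have fE x : D x -> z * kmono 1 x = f x.
  move=> /(exterior_neq0 rho0) x0; rewrite kmono_rec// expr1 /f /kmono.
  by rewrite expr0 invr1 mul1r.
rewrite -cintegralZ//; last exact: cintegrable_kmono.
rewrite (eq_cintegral mu fE).
have [fr fi] : cintegrable mu D f.
  apply: (cintegrable_bound mD _ (integrable_scale_sqrV (normc z * kernel_bound))).
    apply: cmeasurableD; last exact: cmeasurable_kernel.
    by have := cmeasurable_powV 1; under eq_fun do rewrite expr1.
  move=> x Dx; rewrite -fE// normcM -mulrA ler_wpM2l ?normc_ge0//.
  have x0 : 0 < `|x| by rewrite normr_gt0 (exterior_neq0 rho0).
  rewrite /kmono normcM normc_real expr1 normfV -[x ^+ 2](real_normK (num_real x)).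
  have -> : `|x|^-1 * normc (kernel z x) =
          (`|x| * normc (kernel z x)) * `|x| ^- 2.
    by field; rewrite gt_eqF.
  by rewrite ler_wpM2r ?invr_ge0 ?exprn_ge0//; exact: norm_kernel_le.
have Ref x : complex.Re (f x) = x^-1 + complex.Re (kernel z x) by rewrite ReD.
have Imf x : complex.Im (f x) = complex.Im (kernel z x) by rewrite ImD/= add0r.
have cx x : D x -> {for x, continuous (fun x : R => complex.Re (f x))}.
  move=> /(exterior_neq0 rho0) x0; rewrite (funext Ref).
  by apply: cvgD; [exact: inv_continuous|exact: continuous_Re_kernel].
have cy x : D x -> {for x, continuous (fun x : R => complex.Im (f x))}.
  move=> _; rewrite (funext Imf).
  exact: continuous_Im_kernel.
(* The first term is [ln |x|], an antiderivative of [x^-1] on both half-lines at once. Being even,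
   it drops out of the boundary terms at [rho] and [- rho]. *)
pose F (x : R) := ln (x ^+ 2) / 2 + complex.Re (logker z x).
have dF (x : R) : D x -> is_derive x 1 F (complex.Re (f x)).
  move=> /(exterior_neq0 rho0) x0; rewrite Ref.
  apply: is_deriveD; last exact: is_derive_Re_logker.
  have x2 : 0 < x ^+ 2 by rewrite exprn_even_gt0.
  have hsq : is_derive x 1 (fun y : R => y ^+ 2) ((2%:R * x ^+ 1) *: 1).
    exact: (is_deriveX 2 (@is_derive_id R R^o x 1)).
  have h := is_deriveZ 2^-1 (@is_derive1_comp R (@ln R) (fun y => y ^+ 2) x _ _
    (is_derive1_ln x2) hsq).
  rewrite (_ : x^-1 = 2^-1 *: ((x ^+ 2)^-1 * ((2%:R * x ^+ 1) *: 1))); last first.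
    by rewrite /GRing.scale/=; field.
  rewrite (_ : (fun y => _) = 2^-1 \*: (@ln R \o (fun y : R => y ^+ 2))).
    exact: h.
  by apply/funext => y /=; rewrite /GRing.scale/= mulrC.
have dG : forall y : R, D y ->
    is_derive y 1 (fun t : R => complex.Im (logker z t)) (complex.Im (f y)).
  by move=> y _; rewrite Imf; exact: is_derive_Im_logker.
have Fl : (fun n : nat => F n%:R - F (- n%:R)) @ \oo --> (0 : R).
  rewrite -[X in _ --> X](subrr 0).
  have h1 := @cvg_ln_qker 1 (expr1n _ _).
  have h2 := @cvg_ln_qker (-1) (etrans (sqrrN _) (expr1n _ _)).
  rewrite (_ : (fun n => _) = (fun n : nat =>
    (ln ((n%:R : R) ^+ 2) / 2 - ln (qker z (1 * n%:R)) / 2) -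
    (ln ((n%:R : R) ^+ 2) / 2 - ln (qker z (-1 * n%:R)) / 2))).
    exact: cvgB.
  by apply/funext => n; rewrite /F /= sqrrN mul1r mulN1r.
rewrite /cintegral (Rintegral_exterior_FTC rho0 fr dF cx Fl).
rewrite (Rintegral_exterior_FTC rho0 fi dG cy cvg_Im_logker).
apply/eqP; rewrite eq_complex !ReB !ImB/= sub0r eqxx andbT; apply/eqP.
by rewrite /F/= sqrrN; ring.
Qed.

End PrincipalValue.

(** * Laurent coefficients of the monomial densities *)

Section MonomialExpansion.
Variables (R : realType) (rho : R).
Hypothesis rho0 : 0 < rho.
Local Notation mu := (@lebesgue_measure R).
Local Notation D := (exterior rho).
Let mD := @measurable_exterior R rho.

(* [monoc n k] is the coefficient of [z ^- k.+1] in the expansion at infinity of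
   the integral of [x ^- n.+1 / (z - x)] over the exterior of [rho]. *)
Fixpoint monoc (n k : nat) : R[i] :=
  match n, k with
  | 0, 0 => 0 +i* pi
  | 0, k'.+1 => (- ((rho ^+ k'.+1 - (- rho) ^+ k'.+1) / k'.+1%:R))%:C
  | n'.+1, 0 => cintegral mu D (fun x => (x ^- n'.+2)%:C)
  | n'.+1, k'.+1 => monoc n' k'
  end.

Definition sqrV_mass : R := Rintegral mu D (fun x : R => x ^- 2).

Lemma sqrV_mass_ge0 : 0 <= sqrV_mass.
Proof. by apply: Rintegral_ge0 => x _; rewrite invr_ge0 exprn_even_ge0. Qed.

Lemma Rintegral_scale_sqrV (C : R) :
  Rintegral mu D (fun x => C * x ^- 2) = C * sqrV_mass.
Proof. by rewrite RintegralZl//; exact: integrable_exterior_sqrV. Qed.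

(** One summand for each kind of coefficient: the constant [pi * i], the logarithmic series, and the
    moments. The factor [rho] in the last restores the power lost in
    [x ^- n.+2 <= rho ^- n * x ^- 2]. *)
Definition monoc_bound : R := pi + 2 + 2 * sqrV_mass * rho.

Lemma monoc_bound_ge0 : 0 <= monoc_bound.
Proof.
apply: addr_ge0; first by rewrite addr_ge0 ?pi_ge0.
by rewrite mulr_ge0 ?mulr_ge0 ?sqrV_mass_ge0 ?(ltW rho0).
Qed.

(** The quotient [rho ^+ k / rho ^+ n] is unchanged along the diagonal recursion of [monoc], so only
    the cases [n = 0] and [k = 0] need an estimate. *)
Lemma normc_monoc_le n k :
  normc (monoc n k) <= monoc_bound * rho ^+ k / rho ^+ n.
Proof.
have W0 := sqrV_mass_ge0; have rge0 : 0 <= rho := ltW rho0.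
have pige0 : 0 <= (pi : R) := pi_ge0 R.
elim: n k => [|n IH] [|k] /=.
- rewrite expr0 divr1 mulr1 /monoc_bound /normc expr0n/= add0r sqrtr_sqr.
  by rewrite ger0_norm// -addrA lerDl addr_ge0// ?mulr_ge0.
- rewrite expr0 divr1 normc_real normrN normrM.
  apply: (@le_trans _ _ (2 * rho ^+ k.+1)).
    apply: (@le_trans _ _ (`|rho ^+ k.+1 - (- rho) ^+ k.+1| * 1)).
      rewrite ler_wpM2l// normfV ger0_norm// invf_le1// ?ltr0n//.
      by rewrite ler1n.
    rewrite mulr1; apply: le_trans (ler_normB _ _) _.
    by rewrite !normrX normrN ger0_norm// mulrDl mul1r.
  rewrite ler_wpM2r ?exprn_ge0// /monoc_bound addrAC lerDr.
  by rewrite addr_ge0// ?mulr_ge0.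
- have iP := @cintegrable_powV _ _ rho0 n.
  apply: le_trans (normc_cintegral_le mD iP (integrable_scale_sqrV rho0 (rho ^- n))
    (fun x => @normc_powV_le _ _ rho0 n x)) _.
  rewrite Rintegral_scale_sqrV expr0 mulr1 exprS.
  rewrite [leLHS](_ : _ = (2 * sqrV_mass * rho) / (rho * rho ^+ n)); last first.
    by field; rewrite expf_neq0 gt_eqF.
  rewrite ler_wpM2r ?invr_ge0 ?mulr_ge0 ?exprn_ge0// /monoc_bound lerDr.
  by rewrite addr_ge0.
- apply: le_trans (IH k) _.
  rewrite [leLHS](_ : _ = monoc_bound * rho ^+ k.+1 / rho ^+ n.+1)//.
  by rewrite !exprS; field; rewrite expf_neq0 gt_eqF.
Qed.

Lemma has_sum_kmono n (z : R[i]) : complex.Im z < 0 -> rho < normc z ->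
  has_sum (fun k => monoc n k / z ^+ k.+1) (cintegral mu D (kmono z n.+1)).
Proof.
move=> zm rz.
have z0 : complex.Im z != 0 by rewrite lt_eqF.
have zn : z != 0 by apply: contraTneq zm => ->; rewrite ltxx.
elim: n => [|n IH].
  have rz1 : `|rho| < normc z by rewrite gtr0_norm.
  have rz2 : `|- rho| < normc z by rewrite normrN gtr0_norm.
  have h1 := has_sum_logker z0 rz1.
  have h2 := has_sumZ (c := -1) (has_sum_logker z0 rz2).
  have h3 := has_sumZ (c := - z^-1) (has_sumD h1 h2).
  have pv := cintegral_pv rho0 zm.
  (* The two constants [logker z 0] cancel; [pi * i] becomes the coefficient of index 0 and the
     logarithmic series start at index 1. *)
  have -> : cintegral mu D (kmono z 1) = (0 +i* pi) / z ^+ 1 +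
     - z^-1 * (logker z rho - logker z 0 + -1 * (logker z (- rho) - logker z 0)).
    apply: (mulfI zn); rewrite pv expr1; move: (0 +i* pi) => w.
    by field.
  apply: has_sum_cons => /=; move: h3; congr has_sum.
  apply/funext => k.
  rewrite cnat_real !rmorphN rmorphM rmorphB !rmorphXn fmorphV !rmorphN /=.

  rewrite !expr_div_n [z ^+ k.+2]exprS.
  have kn : (k.+1%:R : R)%:C != 0 by rewrite -cnat_real pnatr_eq0.
  have ze : z ^+ k.+1 != 0 by rewrite expf_neq0.
  move: (z ^+ _) (rho%:C ^+ _) ((- rho%:C) ^+ _) (k.+1%:R%:C) ze kn.
  move=> e1 e2 e3 e4 e10 e40.
  by field; rewrite e10 e40 zn.
have iP := @cintegrable_powV _ _ rho0 n.
have iK := @cintegrable_kmono _ _ _ rho0 zm n.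
have iK1 := @cintegrable_kmono _ _ _ rho0 zm n.+1.
(* Dividing [kmono_rec] by [z] puts the moment in front and shifts the previous expansion by one
   index. *)
have E : cintegral mu D (kmono z n.+2) =
    monoc n.+1 0 / z ^+ 1 + z^-1 * cintegral mu D (kmono z n.+1).
  apply: (mulfI zn); rewrite expr1 mulrDr [z * (_ / z)]mulrC divfK//.
  rewrite mulVKf// -cintegralZ// -cintegralD//.
  apply: eq_cintegral => x /(exterior_neq0 rho0) x0.
  by rewrite kmono_rec.
rewrite E; apply: has_sum_cons; move: (has_sumZ (c := z^-1) IH).
congr has_sum; apply/funext => k /=.
by rewrite [z ^+ k.+2]exprS invfM mulrCA.
Qed.

End MonomialExpansion.

Lemma inv_add_geometric (K : fieldType) (w h : K) N : w != 0 -> w + h != 0 ->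
  (w + h)^-1 - \sum_(0 <= n < N) (-1) ^+ n * h ^+ n * w^-1 ^+ n.+1 =
  (- h / w) ^+ N / (w + h).
Proof.
move=> w0 wh0; elim: N => [|N IH]; first by rewrite big_geq// subr0 mul1r.
rewrite big_nat_recr//= opprD addrA IH ![_ ^+ N.+1]exprS -[- h]mulN1r !exprMn exprVn.
by field; rewrite w0 wh0 expf_neq0.
Qed.

(** * Expansion and analyticity for a density given by a series in [1 / x] *)

Section StieltjesExpansion.
Variables (R : realType) (rho : R) (a : nat -> R) (p : R -> R).
Hypothesis rho0 : 0 < rho.
Local Notation mu := (@lebesgue_measure R).
Local Notation D := (exterior rho).
Let mD := @measurable_exterior R rho.
Let A n : R := `|a n| / rho ^+ n.
Hypothesis cA : cvgn (series A).
Hypothesis pE : forall x, D x -> seq_cvg (series (fun n => a n / x ^+ n.+2)) (p x).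

Let A_ge0 n : 0 <= A n.
Proof. by rewrite divr_ge0 ?exprn_ge0// ltW. Qed.

Definition density_bound : R := limn (series A).

Lemma has_sum_density x : D x -> has_sum (fun n => (a n / x ^+ n.+2)%:C) (p x)%:C.
Proof.
move=> Dx; apply: cvgc_ReIm => /=.
  rewrite (_ : (fun n => _) = series (fun n => a n / x ^+ n.+2)); first exact: pE.
  by apply/funext => n; rewrite /series/= Re_sum.
rewrite (_ : (fun n => _) = fun=> 0); first exact: cvgc_cst.
by apply/funext => n; rewrite /series/= Im_sum/= big1.
Qed.

(** The dependence on [x] is confined to the integrable factor [x ^- 2], so a pointwise truncation
    error integrates to a numerical tail. *)
Lemma density_tail N x : D x ->
  normc ((p x)%:C - series (fun n => (a n / x ^+ n.+2)%:C) N) <=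
  (density_bound - series A N) * x ^- 2.
Proof.
move=> Dx; rewrite mulrC mulrBr -lim_series_scale//.
rewrite -[X in _ <= _ - X]/((fun M => x ^- 2 * series A M) N) -series_scale.
apply: has_sum_tail; [exact: has_sum_density| |exact: cvg_series_scale].
move=> n; rewrite normc_real normrM normfV normrX mulrCA ler_wpM2l// mulrC.
exact: exterior_expr_le.
Qed.

Lemma normr_density_le x : D x -> `|p x| <= density_bound * x ^- 2.
Proof.
move=> Dx; have := density_tail 0 Dx.
by rewrite /series/= !big_geq// !subr0 normc_real.
Qed.

Lemma measurable_density : measurable_fun (D : set (measurableTypeR R)) p.
Proof.
apply: (@measurable_fun_cvg _ (measurableTypeR R) R D
  (fun N (x : R) => \sum_(0 <= n < N) a n / x ^+ n.+2) p).
  move=> N; apply: measurable_sum => n; apply: measurable_funM.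
    exact: measurable_cst.
  apply: measurable_fun_inv.
    by move=> x /(exterior_neq0 rho0) x0; rewrite expf_neq0.
  by apply: measurable_funX; exact: measurable_id.
by move=> x Dx; exact: pE.
Qed.

Let cmp : cmeasurable (D : set (measurableTypeR R)) (fun x => (p x)%:C).
Proof. by apply: cmeasurable_real; exact: measurable_density. Qed.

Lemma cintegrable_density_mul (f : R -> R[i]) (C : R) : 0 <= C ->
  cmeasurable (D : set (measurableTypeR R)) f ->
  (forall x, D x -> normc (f x) <= C) ->
  cintegrable mu D (fun x => (p x)%:C * f x).
Proof.
move=> C0 mf fC.
apply: (cintegrable_bound mD (cmeasurableM cmp mf)
  (integrable_scale_sqrV rho0 (C * density_bound))) => x Dx.
rewrite normcM normc_real -mulrA mulrC; apply: ler_pM => //.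
- exact: normc_ge0.
- exact: fC.
- exact: normr_density_le.
Qed.

Definition density_stieltjes (z : R[i]) : R[i] :=
  cintegral mu D (fun x => (p x)%:C * kernel z x).

(** Termwise integration with an explicit error: the truncation error of [p] is bounded by
    [density_tail] and the kernel by [1 / |Im z|]. *)
Lemma density_stieltjes_monos (z : R[i]) : complex.Im z < 0 ->
  has_sum (fun n => (a n)%:C * cintegral mu D (kmono z n.+2)) (density_stieltjes z).
Proof.
move=> zm; have z0 : complex.Im z != 0 by rewrite lt_eqF.
have v0 : 0 <= `|complex.Im z|^-1 by rewrite invr_ge0.
have mk := cmeasurable_kernel z0 mD.
pose F n x := (a n)%:C * kmono z n.+2 x.
have iF n : cintegrable mu D (F n).
  by apply: cintegrableZ => //; exact: cintegrable_kmono.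
have ip : cintegrable mu D (fun x => (p x)%:C * kernel z x).
  apply: (cintegrable_density_mul v0 mk) => x _; exact: normc_kernel_le.
apply: (@cvgc_bound _ _ _ (fun N => (2 * (`|complex.Im z|^-1 * sqrV_mass rho)) *
    (density_bound - series A N))).
  exact: cvg_series_tail.
apply: nearW => N; rewrite -normc_opp opprB.
have [iS SE] := cintegral_sum mD N iF.
rewrite (_ : series _ N = cintegral mu D (fun x => \sum_(0 <= n < N) F n x)); last first.
  rewrite SE /series/=; apply: eq_bigr => n _.
  by rewrite cintegralZ//; exact: cintegrable_kmono.
have -> : density_stieltjes z - cintegral mu D (fun x => \sum_(0 <= n < N) F n x) =
   cintegral mu D (fun x => (p x)%:C * kernel z x + -1 * \sum_(0 <= n < N) F n x).
  by rewrite cintegralD// ?cintegralZ// ?mulN1r//; exact: cintegrableZ.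
pose C := `|complex.Im z|^-1 * (density_bound - series A N).
have -> : 2 * (`|complex.Im z|^-1 * sqrV_mass rho) * (density_bound - series A N) =
  2 * (C * sqrV_mass rho) by rewrite /C; ring.
rewrite -Rintegral_scale_sqrV//.
apply: normc_cintegral_le => //.
- by apply: cintegrableD => //; exact: cintegrableZ.
- exact: integrable_scale_sqrV.
move=> x Dx.
rewrite (_ : _ + _ = ((p x)%:C - series (fun n => (a n / x ^+ n.+2)%:C) N) * kernel z x).
  rewrite normcM mulrC -mulrA; apply: ler_pM; rewrite ?normc_ge0//.
    exact: normc_kernel_le.
  exact: density_tail.
rewrite mulrBl mulN1r; congr (_ - _).
rewrite /series/= mulr_suml; apply: eq_bigr => n _.
by rewrite /F /kmono rmorphM mulrA.
Qed.

(** The row is [n.+1] because [a n] multiplies [x ^- n.+2], while [monoc n] belongs to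
    [x ^- n.+1]. *)
Definition laurentc (k : nat) : R[i] := csum (fun n => (a n)%:C * monoc rho n.+1 k).

Let M := monoc_bound rho / rho.

Let M_ge0 : 0 <= M.
Proof. by rewrite divr_ge0 ?monoc_bound_ge0// ltW. Qed.

Let term_le n k :
  normc ((a n)%:C * monoc rho n.+1 k) <= M * rho ^+ k * A n.
Proof.
rewrite normcM normc_real.
rewrite [leRHS](_ : _ = `|a n| * (monoc_bound rho * rho ^+ k / rho ^+ n.+1)).
  by rewrite ler_wpM2l//; exact: normc_monoc_le.
by rewrite /M /A exprS; field; rewrite expf_neq0 gt_eqF.
Qed.

Lemma has_sum_laurentc k :
  has_sum (fun n => (a n)%:C * monoc rho n.+1 k) (laurentc k).
Proof.
by apply: (has_csum (term_le^~ k)); exact: cvg_series_scale.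
Qed.

Lemma normc_laurentc_le k : normc (laurentc k) <= (M * density_bound) * rho ^+ k.
Proof.
apply: le_trans (normc_csum_le (term_le^~ k) _) _; first exact: cvg_series_scale.
by rewrite lim_series_scale// mulrAC.
Qed.

(** The rows are the expansions of the monomial integrals and the columns sum to [laurentc]. The
    product majorant is [A n] times a geometric sequence of ratio [rho / normc z]. *)
Lemma has_sum_density_stieltjes (z : R[i]) :
  complex.Im z < 0 -> rho < normc z ->
  has_sum (fun k => laurentc k / z ^+ k.+1) (density_stieltjes z).
Proof.
move=> zm rz; have z1 : 0 < normc z by exact: lt_trans rz.
apply: (@has_sum_exchange _ (fun n k => (a n)%:C * (monoc rho n.+1 k / z ^+ k.+1))
  A (fun k => (M / normc z) * (rho / normc z) ^+ k)
  (fun n => (a n)%:C * cintegral mu D (kmono z n.+2))).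
- exact: A_ge0.
- move=> k; apply: mulr_ge0; first by rewrite divr_ge0 ?normc_ge0.
  by rewrite exprn_ge0// divr_ge0 ?normc_ge0 ?(ltW rho0).
- move=> n k; rewrite mulrA normcM normcV normcX.
  rewrite [leRHS](_ : _ = M * rho ^+ k * A n / normc z ^+ k.+1).
    by rewrite ler_wpM2r ?invr_ge0 ?exprn_ge0 ?normc_ge0//; exact: term_le.
  by rewrite expr_div_n exprS; field; rewrite expf_neq0 gt_eqF.
- exact: cA.
- apply: cvg_geom_series; first by rewrite divr_ge0 ?normc_ge0 ?(ltW rho0).
  by rewrite ltr_pdivrMr// mul1r.
- by move=> n; apply: has_sumZ; exact: has_sum_kmono.
- exact: density_stieltjes_monos.
- move=> k; have := has_sumZ (c := (z ^+ k.+1)^-1) (@has_sum_laurentc k).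
  rewrite [X in has_sum _ X]mulrC; congr has_sum.
  by apply/funext => n; rewrite mulrC mulrA.
Qed.

(** The radius is the distance from [z0] to the real line: within it [z] stays in the half plane,
    and the geometric series of the kernel in [h = z - z0] has ratio at most [|h| / |Im z0| < 1],
    uniformly in [x]. *)
Lemma density_stieltjes_analytic (z0 : R[i]) : complex.Im z0 < 0 ->
  exists c : nat -> R[i], exists2 d : R, 0 < d & forall z, normc (z - z0) < d ->
    complex.Im z < 0 /\
    has_sum (fun n => c n * (z - z0) ^+ n) (density_stieltjes z).
Proof.
move=> zm; have zn : complex.Im z0 != 0 by rewrite lt_eqF.
set v := `|complex.Im z0|.
have v0 : 0 < v by rewrite normr_gt0.
have mk := cmeasurable_kernel zn mD.
have kX n x : normc (kernel z0 x ^+ n) <= v^-1 ^+ n.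
  rewrite normcX; apply: lerXn2r; rewrite ?nnegrE ?normc_ge0 ?invr_ge0 ?(ltW v0)//.
  exact: normc_kernel_le.
have vX n : 0 <= v^-1 ^+ n by rewrite exprn_ge0// invr_ge0 ltW.
have iK n : cintegrable mu D (fun x => (p x)%:C * kernel z0 x ^+ n).
  apply: (cintegrable_density_mul (vX n)) => [|x _]; last exact: kX.
  exact: cmeasurableX.
exists (fun n => (-1) ^+ n * cintegral mu D (fun x => (p x)%:C * kernel z0 x ^+ n.+1)).
exists v => // z; set h := z - z0 => hv.
have zE : z = z0 + h by rewrite /h addrC subrK.
have zm' : complex.Im z < 0.
  have : complex.Im h < v.
    by apply: le_lt_trans (ler_norm _) _; apply: le_lt_trans (normIm_le _) hv.
  rewrite /v ltr0_norm// zE (ImD z0 h) => hlt.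
  by rewrite -[ltRHS](subrr (complex.Im z0)) ltrD2l.
split=> //.
have z1 : complex.Im z != 0 by rewrite lt_eqF.
have w0 : 0 <= `|complex.Im z|^-1 by rewrite invr_ge0.
have mkz := cmeasurable_kernel z1 mD.
pose s := normc h / v.
have s0 : 0 <= s by rewrite divr_ge0 ?normc_ge0 ?(ltW v0).
have s1 : `|s| < 1 by rewrite ger0_norm// ltr_pdivrMr// mul1r.
pose F n x := ((-1) ^+ n * h ^+ n) * ((p x)%:C * kernel z0 x ^+ n.+1).
have iF n : cintegrable mu D (F n) by exact: cintegrableZ.
have ip : cintegrable mu D (fun x => (p x)%:C * kernel z x).
  by apply: (cintegrable_density_mul w0 mkz) => x _; exact: normc_kernel_le.
pose C := `|complex.Im z|^-1 * density_bound.
apply: (@cvgc_bound _ _ _ (fun N => (2 * (C * sqrV_mass rho)) * s ^+ N)).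
  rewrite -[X in _ --> X](mulr0 (2 * (C * sqrV_mass rho))).
  by apply: cvgM; [exact: cvg_cst|exact: cvg_expr].
apply: nearW => N; rewrite -normc_opp opprB.
have [iS SE] := cintegral_sum mD N iF.
rewrite (_ : series _ N = cintegral mu D (fun x => \sum_(0 <= n < N) F n x)); last first.
  rewrite SE /series/=; apply: eq_bigr => n _.
  by rewrite cintegralZ// mulrAC.
have -> : density_stieltjes z - cintegral mu D (fun x => \sum_(0 <= n < N) F n x) =
   cintegral mu D (fun x => (p x)%:C * kernel z x + -1 * \sum_(0 <= n < N) F n x).
  by rewrite cintegralD// ?cintegralZ// ?mulN1r//; exact: cintegrableZ.
have -> : 2 * (C * sqrV_mass rho) * s ^+ N = 2 * ((C * s ^+ N) * sqrV_mass rho) by ring.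
rewrite -Rintegral_scale_sqrV//.
apply: normc_cintegral_le => //.
- by apply: cintegrableD => //; exact: cintegrableZ.
- exact: integrable_scale_sqrV.
move=> x Dx.
(* The remainder of the finite geometric sum is exact, which exhibits the factor bounded by
   [s ^+ N]. *)
have -> : (p x)%:C * kernel z x + -1 * (\sum_(0 <= n < N) F n x) =
  (p x)%:C * ((- h * kernel z0 x) ^+ N * kernel z x).
  have zx : z - x%:C = (z0 - x%:C) + h by rewrite zE addrAC.
  have k0 := kernel_neq0 zn x; have k1 := kernel_neq0 z1 x.
  rewrite zx in k1; rewrite /kernel zx -inv_add_geometric// mulrBr mulN1r mulr_sumr.
  by congr (_ - _); apply: eq_bigr => n _; rewrite /F /kernel mulrCA.
rewrite normcM normc_real.
rewrite (_ : C * s ^+ N * x ^- 2 =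
   (density_bound * x ^- 2) * (s ^+ N * `|complex.Im z|^-1)); last by rewrite /C; ring.
apply: ler_pM; rewrite ?normc_ge0//; first exact: normr_density_le.
rewrite normcM; apply: ler_pM; rewrite ?normc_ge0//; last exact: normc_kernel_le.
rewrite normcX normcM normc_opp; apply: lerXn2r; rewrite ?nnegrE//.
  by rewrite mulr_ge0 ?normc_ge0.
by rewrite /s ler_wpM2l ?normc_ge0//; exact: normc_kernel_le.
Qed.

End StieltjesExpansion.

(** * Integration against a measure with a density *)

(** Equality on sets determines [lam] as a measure; integrability of [g] makes it finite, and the
    change of variables through the Radon-Nikodym derivative then applies. Boundedness of [f] makes
    it integrable against [lam]. *)
Lemma Rintegral_density (d : measure_display) (T : measurableType d) (R : realType)
    (mu : {sigma_finite_measure set T -> \bar R})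
    (lam : {measure set T -> \bar R}) (g f : T -> R) (B : R) :
  mu.-integrable setT (EFin \o g) ->
  (forall A, measurable A -> lam A = (\int[mu]_(x in A) (g x)%:E)%E) ->
  measurable_fun setT f -> (forall x, `|f x| <= B) ->
  Rintegral lam setT f = Rintegral mu setT (fun x => f x * g x).
Proof.
move=> gi lamE mf fB.
have gA A : measurable A -> mu.-integrable A (EFin \o g).
  by move=> mA; exact: integrableS gi.
have lamfin : fin_num_fun lam.
  by move=> A mA; rewrite lamE//; exact: integrable_fin_num (gA _ mA).
have lamsf : sigma_finite setT lam.
  by apply: fin_num_fun_sigma_finite => //; rewrite measure0.
pose H1 := isFinite.Build _ _ _ _ lamfin.
pose H2 := isSFinite.Build _ _ _ _ (sfinite_measure_sigma_finite lamsf).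
pose H3 := isSigmaFinite.Build _ _ _ _ lamsf.
pose nu := HB.pack_for (FiniteMeasure.type T R) (Measure.sort lam) H1 H2 H3.
have lamnu : lam = nu by exact: eq_measure.
have dom : nu `<< mu.
  apply/null_content_dominatesP => A mA muA0.
  change (lam A = 0%E); rewrite lamE// null_set_integral//.
  exact: measurable_int (gA A mA).
have nui : nu.-integrable setT (EFin \o f).
  apply: measurable_bounded_integrable => //.
    exact: fin_num_fun_lty lamfin.
  exists B; split; first exact: num_real.
  by move=> x Bx y _; apply: le_trans (fB y) _; exact: ltW.
rewrite /Rintegral; congr fine.
rewrite [in LHS]lamnu -(Radon_Nikodym_change_of_variables dom measurableT nui).
apply: ae_eq_integral => //.
- apply: emeasurable_funM; first exact: measurable_int nui.
  by apply: measurable_int; apply: Radon_Nikodym_integrable.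
- by apply/measurable_EFinP; apply: measurable_funM => //;
    exact/measurable_EFinP/(measurable_int _ gi).
(* The derivative and [g] have the same integral over every measurable set, hence agree almost
   everywhere. *)
have rn : ae_eq mu setT (Radon_Nikodym (charge_of_finite_measure nu) mu) (EFin \o g).
  apply: integral_ae_eq => //.
  - exact: Radon_Nikodym_integrable.
  - exact: measurable_int gi.
  move=> A _ mA; rewrite -Radon_Nikodym_integral//.
  by rewrite -lamE.
by have := ae_eqe_mul2l (EFin \o f) rn.
Qed.

Section StieltjesDensity.
Variables (R : realType) (rho : R) (a : nat -> R) (p : R -> R).
Hypothesis rho0 : 0 < rho.
Local Notation mu := (@lebesgue_measure R).
Local Notation D := (exterior rho).
Let mD := @measurable_exterior R rho.
Hypothesis cA : cvgn (series (fun n => `|a n| / rho ^+ n)).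
Hypothesis pE : forall x, D x -> seq_cvg (series (fun n => a n / x ^+ n.+2)) (p x).
Variable lam : {measure set (measurableTypeR R) -> \bar R}.
Hypothesis lamE : forall A : set (measurableTypeR R), measurable A ->
  lam A = (\int[mu]_(x in A) (p x * \1_D x)%:E)%E.

Lemma integrable_density : mu.-integrable D (EFin \o p).
Proof.
apply: (le_integrable mD) (integrable_scale_sqrV rho0 (density_bound rho a)).
  by apply/measurable_EFinP; exact: measurable_density pE.
move=> x Dx /=; rewrite lee_fin.
apply: le_trans (normr_density_le rho0 cA pE Dx) _; exact: ler_norm.
Qed.

Lemma Rintegral_lam (f : R -> R) (B : R) : continuous f ->
  (forall x, `|f x| <= B) ->
  Rintegral lam setT f = Rintegral mu D (fun x => f x * p x).
Proof.
move=> cf fB.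
have gE : (EFin \o (fun x => p x * \1_D x)) = (EFin \o p) \_ D.
  apply/funext => x; rewrite patchE /= indicE.
  by case: (x \in D); rewrite ?mulr1 ?mulr0.
rewrite (@Rintegral_density _ _ _ mu lam (fun x => p x * \1_D x) f B)//.
- rewrite [RHS]Rintegral_mkcond; apply: eq_Rintegral => x _.
  by rewrite patchE indicE; case: (x \in D); rewrite ?mulr1 ?mulr0.
- rewrite gE; apply/integrable_restrict => //.
  by rewrite setTI; exact: integrable_density.
- exact: continuous_measurable_fun.
Qed.

Lemma stieltjes_transform_density (z : R[i]) : complex.Im z < 0 ->
  stieltjes_transform lam z = density_stieltjes rho p z.
Proof.
move=> zm; have z0 : complex.Im z != 0 by rewrite lt_eqF.
rewrite /stieltjes_transform /complex_integral /density_stieltjes /cintegral.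
congr (_ +i* _).
  rewrite (@Rintegral_lam _ `|complex.Im z|^-1 (continuous_Re_kernel z0)).
    by apply: eq_Rintegral => x _; rewrite Re_scale mulrC.
  by move=> x; apply: le_trans (normRe_le _) _; exact: normc_kernel_le.
rewrite (@Rintegral_lam _ `|complex.Im z|^-1 (continuous_Im_kernel z0)).
  by apply: eq_Rintegral => x _; rewrite Im_scale mulrC.
by move=> x; apply: le_trans (normIm_le _) _; exact: normc_kernel_le.
Qed.

End StieltjesDensity.

Theorem proposition2p2 (R : realType) (r rho : R) (hr : 0 < r) (hrho : r < rho)
    (a : nat -> R) (p : R -> R)
    (p_abs : forall x : R, r < `|x| ->
      cvgn (fun N : nat => \sum_(2 <= n < N) `|a n / x ^+ n|))
    (p_series : forall x : R, r < `|x| ->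
      (fun N : nat => \sum_(2 <= n < N) a n / x ^+ n) @ \oo --> p x)
    (p_ge0 : forall x : R, rho <= `|x| -> 0 <= p x)
    (lam : {measure set (measurableTypeR R) -> \bar R})
    (lamE : forall A : set (measurableTypeR R), measurable A ->
      lam A = (\int[lebesgue_measure]_(x in A)
                 (p x * \1_[set y : R | rho <= `|y|] x)%:E)%E) :
  exists Gt : R[i] -> R[i],
    [/\ analytic_on (K := R[i]) (@lower_half_plane R `|` disk_exterior rho) Gt,
        forall z : R[i], lower_half_plane z -> Gt z = stieltjes_transform lam z
      & exists b : nat -> R[i],
          forall z : R[i], disk_exterior rho z ->
            has_sum (fun n => b n / z ^+ n.+1) (Gt z)].
Proof.
have rho0 : 0 < rho := lt_trans hr hrho.
pose al n := a n.+2.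
have cvg2 (u : nat -> R) (l : R) :
    (fun N : nat => \sum_(2 <= n < N) u n) @ \oo --> l ->
    series (fun n => u n.+2) @ \oo --> l.
  move=> h; rewrite (_ : series _ = fun N => \sum_(2 <= n < N + 2) u n).
    by rewrite -(cvg_shiftn 2) in h.
  apply/funext => N; rewrite /series/= -[2%N]/(0 + 2)%N big_addn addnK.
  by apply: eq_bigr => i _; rewrite addn2.
have cA : cvgn (series (fun n => `|al n| / rho ^+ n)).
  have rr : r < `|rho| by rewrite gtr0_norm.
  have h : cvgn (series (fun n => `|a n.+2 / rho ^+ n.+2|)).
    have /cvg_ex[l hl] := p_abs rho rr.
    by apply/cvg_ex; exists l; exact: (cvg2 (fun n => `|a n / rho ^+ n|)).
  (* Absolute convergence is used at the point [x = rho]; the factor [rho ^+ 2] accounts for the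
     shift of index by two. *)
  rewrite (_ : (fun n => _) = (fun n => rho ^+ 2 * `|a n.+2 / rho ^+ n.+2|)).
    exact: cvg_series_scale.
  apply/funext => n; rewrite normrM normfV normrX (gtr0_norm rho0) /al.
  by rewrite -[n.+2]add2n exprD; field; rewrite expf_neq0 gt_eqF.
have pE x : exterior rho x -> seq_cvg (series (fun n => al n / x ^+ n.+2)) (p x).
  move=> Dx; apply: (cvg2 (fun n => a n / x ^+ n)); apply: p_series.
  exact: lt_le_trans hrho Dx.
pose b := laurentc rho al; pose G := density_stieltjes rho p.
have bC := normc_laurentc_le rho0 cA.
have GE (z : R[i]) : complex.Im z < 0 -> rho < normc z ->
    G z = csum (fun n => b n / z ^+ n.+1).
  move=> zm rz.
  apply: has_sum_uniq (has_sum_density_stieltjes rho0 cA pE zm rz) _.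
  exact: has_sum_laurent rho0 bC rz.
have diskE (z : R[i]) : disk_exterior rho z -> rho < normc z.
  by rewrite /disk_exterior/= normcE ltcR.
(* Real points with [|z| > rho] fall under the Laurent series. The values on the part of the closed
   disk outside the half plane are arbitrary and lie outside the domain of the claim. *)
exists (fun z => if complex.Im z < 0 then G z else csum (fun n => b n / z ^+ n.+1)).
split.
- apply: analytic_on_normc => z0 Uz0.
  have [zm|zm] := boolP (complex.Im z0 < 0).
    have [c [d d0 hc]] := density_stieltjes_analytic rho0 cA pE zm.
    by exists c, d => // z /hc[-> ].
  have rz : rho < normc z0 by case: Uz0 => [/= zm'|/diskE//]; rewrite zm' in zm.
  have [c [d d0 hc]] := laurent_analytic rho0 bC rz.
  (* Around a real [z0] this disk meets the lower half plane, where [GE] turns the integral into the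
     Laurent series. *)
  exists c, d => // z /hc[rz' hz].
  case: ifPn => zm'; last exact: hz.
  rewrite (GE _ zm' rz'); exact: hz.
- move=> z zm; rewrite ifT//.
  by rewrite (stieltjes_transform_density rho0 cA pE lamE zm).
- exists b => z /diskE rz; case: ifPn => zm; last exact: has_sum_laurent rho0 bC rz.
  exact: has_sum_density_stieltjes.
Qed.
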